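(* Let $-1<\lambda\le1$, let $s\ne0$ be purely imaginary and let $\alpha>0$. Then the operator $T=\begin{bmatrix}B(s)&\alpha(B(s)-B)\\0&B\end{bmatrix}$ on $L^2(\mathbb T)\oplus L^2(\mathbb T)$ is irreducible.
   Context: $L^2(\mathbb T)$ is normalized so that $\{z^n\}_{n\in\mathbb Z}$ is an orthonormal basis. $B$ is the unweighted bi-lateral shift $Bz^n=z^{n+1}$ and $B(s)$ (depending also on $\lambda$) is the weighted bi-lateral shift $B(s)z^n=\frac{n+\frac{1+\lambda}2+s}{n+\frac{1+\lambda}2-s}z^{n+1}$, $n\in\mathbb Z$. An operator is irreducible if it has no non-trivial reducing subspace. *)

(* Defs.v *)
From HB Require Import structures.
From mathcomp Require Import all_boot all_order all_algebra.
From mathcomp Require Import all_classical all_reals all_analysis.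
From mathcomp Require Import measurable_realfun ring_quotient sesquilinear.
From mathcomp.real_closed Require Import complex.
Set Implicit Arguments.
Unset Strict Implicit.
Unset Printing Implicit Defensive.
Import Order.TTheory GRing.Theory Num.Theory.
Import numFieldNormedType.Exports.

Local Open Scope ring_scope.
Local Open Scope classical_set_scope.
Local Open Scope quotient_scope.
Local Open Scope complex_scope.

Local Notation reC := complex.Re.
Local Notation imC := complex.Im.

Section L2circle.
Variable R : realType.

Lemma twopi_gt0 : (0 : R) < pi *+ 2.
Proof. by rewrite pmulrn_lgt0 // pi_gt0. Qed.

(* The circle is parametrized by the angle t in [0, 2 pi]: functions on the
   circle are functions of t, taken modulo equality almost everywhere for the
   normalized Lebesgue measure dt / (2 pi) on [0, 2 pi] (so values outside
   [0, 2 pi] are irrelevant). *)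
Definition circle_measure : probability (measurableTypeR R) R :=
  uniform_prob twopi_gt0.
Local Notation mu := circle_measure.

Definition sqint : {pred R -> R[i]} :=
  fun f => ((fun t => reC (f t)) \in Lfun mu 2%:E) &&
           ((fun t => imC (f t)) \in Lfun mu 2%:E).

Lemma reCM (x y : R[i]) : reC (x * y) = reC x * reC y - imC x * imC y.
Proof. by case: x y => [a b] [c d]. Qed.

Lemma imCM (x y : R[i]) : imC (x * y) = reC x * imC y + imC x * reC y.
Proof. by case: x y => [a b] [c d]. Qed.

Lemma reCD (x y : R[i]) : reC (x + y) = reC x + reC y.
Proof. by case: x y => [a b] [c d]. Qed.

Lemma imCD (x y : R[i]) : imC (x + y) = imC x + imC y.
Proof. by case: x y => [a b] [c d]. Qed.

Lemma reC_conj (x : R[i]) : reC (Num.conj x) = reC x.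
Proof. by case: x. Qed.

Lemma imC_conj (x : R[i]) : imC (Num.conj x) = - imC x.
Proof. by case: x. Qed.

Lemma LfunD2 (f g : R -> R) : f \in Lfun mu 2%:E -> g \in Lfun mu 2%:E ->
  (fun t => f t + g t) \in Lfun mu 2%:E.
Proof.
move=> hf hg; have [_ /(_ 1 f g hf hg)] := Lfun_submod_closed mu (lee1n 2).
by rewrite scale1r.
Qed.

Lemma LfunZ2 (a : R) (f : R -> R) : f \in Lfun mu 2%:E ->
  (fun t => a * f t) \in Lfun mu 2%:E.
Proof.
move=> hf; have [h0 h] := Lfun_submod_closed mu (lee1n 2).
by have := h a f _ hf h0; rewrite addr0.
Qed.

Lemma sqint_submod_closed : submod_closed sqint.
Proof.
split; first by apply/andP; split; exact: (Lfun_submod_closed mu (lee1n 2)).1.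
move=> a f g /andP[f1 f2] /andP[g1 g2]; apply/andP; split.
  rewrite [X in X \in _](_ : _ = fun t =>
    (reC a * reC (f t) + (- imC a) * imC (f t)) + reC (g t)).
    by apply: LfunD2 => //; apply: LfunD2; exact: LfunZ2.
  by apply/funext => t; rewrite reCD reCM mulNr.
rewrite [X in X \in _](_ : _ = fun t =>
    (reC a * imC (f t) + imC a * reC (f t)) + imC (g t)).
  by apply: LfunD2 => //; apply: LfunD2; exact: LfunZ2.
by apply/funext => t; rewrite imCD imCM.
Qed.

HB.instance Definition _ :=
  GRing.isSubmodClosed.Build R[i] (R -> R[i]) sqint sqint_submod_closed.

Record L2fun := MkL2fun { L2val :> R -> R[i] ; L2valP : L2val \in sqint }.

HB.instance Definition _ := [isSub for L2val].
HB.instance Definition _ := [Choice of L2fun by <:].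
HB.instance Definition _ := [SubChoice_isSubLmodule of L2fun by <:].

Lemma ae_circle : Filter (almost_everywhere mu).
Proof. exact: ae_filter_ringOfSetsType. Qed.
Local Existing Instance ae_circle.

Definition null_L2fun : {pred L2fun} :=
  fun f => `[< {ae mu, forall t, f t = 0} >].

Lemma null_L2fun_submod_closed : submod_closed null_L2fun.
Proof.
split; first by apply/asboolP; apply: aeW => t.
move=> a f g /asboolP nf /asboolP ng; apply/asboolP.
by apply: filterS2 nf ng => t ft gt; rewrite -[LHS]/(a * f t + g t) ft gt mulr0 addr0.
Qed.

HB.instance Definition _ :=
  GRing.isSubmodClosed.Build R[i] L2fun null_L2fun
    null_L2fun_submod_closed.

Definition L2T := {ideal_quot null_L2fun}.
HB.instance Definition _ := GRing.Zmodule.on L2T.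
HB.instance Definition _ := EqQuotient.on L2T.

Lemma L2T_eqP (f g : L2fun) :
  reflect ({ae mu, forall t, f t = g t}) (\pi_L2T f == \pi_L2T g).
Proof.
rewrite -Quotient.idealrBE.
apply: (@iffP ({ae mu, forall t, f t - g t = 0})) => [|h|h]; first exact: asboolP.
  by apply: filterS h => t /= /subr0_eq.
by apply: filterS h => t /= ->; rewrite subrr.
Qed.

Definition scaleL2T (a : R[i]) (u : L2T) : L2T := \pi_L2T (a *: repr u).

Lemma scaleL2T_pi a f : scaleL2T a (\pi f) = \pi_L2T (a *: f).
Proof.
apply/eqP; rewrite -Quotient.idealrBE -scalerBr; apply: rpredZ.
by rewrite Quotient.idealrBE reprK.
Qed.

Lemma scaleL2TA a b u : scaleL2T a (scaleL2T b u) = scaleL2T (a * b) u.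
Proof. by rewrite [scaleL2T b u]/scaleL2T scaleL2T_pi scalerA. Qed.

Lemma scaleL2T1 : left_id 1 scaleL2T.
Proof. by move=> u; rewrite /scaleL2T scale1r reprK. Qed.

Lemma scaleL2TDr : right_distributive scaleL2T +%R.
Proof.
move=> a u v; elim/quotW: u => f; elim/quotW: v => g.
by rewrite -raddfD !scaleL2T_pi scalerDr raddfD.
Qed.

Lemma scaleL2TDl u : {morph scaleL2T^~ u : a b / a + b}.
Proof. by move=> a b; rewrite /scaleL2T scalerDl raddfD. Qed.

HB.instance Definition _ := GRing.Zmodule_isLmodule.Build R[i] L2T
  scaleL2TA scaleL2T1 scaleL2TDr scaleL2TDl.

Definition Cintegral (f : R -> R[i]) : R[i] :=
  (\int[mu]_t reC (f t)) +i* (\int[mu]_t imC (f t)).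

Definition dotfun (f g : L2fun) : R[i] :=
  Cintegral (fun t => f t * Num.conj (g t)).

Lemma L2fun_re (f : L2fun) : (fun t => reC (f t)) \in Lfun mu 2%:E.
Proof. by have /andP[] := L2valP f. Qed.

Lemma L2fun_im (f : L2fun) : (fun t => imC (f t)) \in Lfun mu 2%:E.
Proof. by have /andP[] := L2valP f. Qed.

Lemma integrableM2 (f g : R -> R) : f \in Lfun mu 2%:E -> g \in Lfun mu 2%:E ->
  mu.-integrable setT (fun t => (f t * g t)%:E).
Proof. by move=> hf hg; apply/Lfun1_integrable; exact: Lfun2_mul_Lfun1. Qed.

Definition Cintegrable (f : R -> R[i]) :=
  mu.-integrable setT (fun t => (reC (f t))%:E) /\
  mu.-integrable setT (fun t => (imC (f t))%:E).

Lemma CintegrableM (f g : L2fun) : Cintegrable (fun t => f t * Num.conj (g t)).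
Proof.
split.
  under eq_fun do rewrite reCM reC_conj imC_conj mulrN opprK EFinD.
  apply: integrableD => //; apply: integrableM2;
    [exact: L2fun_re..|exact: L2fun_im|exact: L2fun_im].
under eq_fun do rewrite imCM reC_conj imC_conj mulrN addrC EFinB.
by apply: integrableB => //; apply: integrableM2;
  rewrite ?L2fun_re ?L2fun_im.
Qed.

Lemma CintegralD f g : Cintegrable f -> Cintegrable g ->
  Cintegral (fun t => f t + g t) = Cintegral f + Cintegral g.
Proof.
move=> [f1 f2] [g1 g2]; rewrite /Cintegral.
under eq_Rintegral do rewrite reCD.
under [X in _ +i* X]eq_Rintegral do rewrite imCD.
by rewrite !RintegralD.
Qed.

Lemma CintegralZ a f : Cintegrable f ->
  Cintegral (fun t => a * f t) = a * Cintegral f.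
Proof.
move=> [f1 f2]; rewrite /Cintegral.
have iZ b (h : R -> R) : mu.-integrable setT (EFin \o h) ->
    mu.-integrable setT (EFin \o (fun t => b * h t)).
  move=> ih; rewrite (_ : _ \o _ = fun t => b%:E * (h t)%:E)%E.
    exact: integrableZl.
  by apply/funext => t; rewrite /= EFinM.
under eq_Rintegral do rewrite reCM.
under [X in _ +i* X]eq_Rintegral do rewrite imCM.
rewrite RintegralB ?RintegralD ?RintegralZl//; try exact: iZ.
by case: a.
Qed.

Lemma Cintegral_ae_eq (f g : R -> R[i]) : Cintegrable f -> Cintegrable g ->
  {ae mu, forall t, f t = g t} -> Cintegral f = Cintegral g.
Proof.
move=> [f1 f2] [g1 g2] fg; rewrite /Cintegral /Rintegral.
congr (fine _ +i* fine _).
  apply: ae_eq_integral => //.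
  - exact: measurable_int f1.
  - exact: measurable_int g1.
  - by apply: (filterS _ fg) => t /= -> _.
apply: ae_eq_integral => //.
- exact: measurable_int f2.
- exact: measurable_int g2.
- by apply: (filterS _ fg) => t /= -> _.
Qed.

Lemma dotfun_ae (f f' g g' : L2fun) :
  \pi_L2T f = \pi_L2T f' -> \pi_L2T g = \pi_L2T g' ->
  dotfun f g = dotfun f' g'.
Proof.
move=> /eqP/L2T_eqP hf /eqP/L2T_eqP hg.
apply: Cintegral_ae_eq; [exact: CintegrableM..|].
by apply: filterS2 hf hg => t -> ->.
Qed.

(* Linear in the first argument, conjugate linear in the second. *)
Definition dotL2T (u v : L2T) : R[i] := dotfun (repr u) (repr v).

Lemma dotL2T_pi f g : dotL2T (\pi f) (\pi g) = dotfun f g.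
Proof. by apply: dotfun_ae; rewrite reprK. Qed.

Lemma dotL2TC u v : dotL2T u v = Num.conj (dotL2T v u).
Proof.
rewrite /dotL2T /dotfun /Cintegral.
under eq_Rintegral do rewrite mulrC -[X in _ * X]conjCK -rmorphM reC_conj.
rewrite [X in _ +i* X](_ : _ = - \int[mu]_t
  (imC (repr v t * Num.conj (repr u t)))); first by [].
have [_ i2] := CintegrableM (repr v) (repr u).
rewrite -mulN1r -RintegralZl//; apply: eq_Rintegral => t _.
by rewrite mulrC -[X in _ * X]conjCK -rmorphM imC_conj mulN1r.
Qed.

Lemma dotL2T_herm u v : dotL2T u v = (-1) ^+ false * Num.conj (dotL2T v u).
Proof. by rewrite expr0 mul1r -dotL2TC. Qed.

Lemma dotL2T_linearl v : linear_for *%R (dotL2T^~ v).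
Proof.
move=> a u w; elim/quotW: u => f; elim/quotW: w => h; elim/quotW: v => g.
rewrite -[a *: _]/(scaleL2T a _) scaleL2T_pi -raddfD !dotL2T_pi /dotfun.
have fg := CintegrableM f g; have hg := CintegrableM h g.
rewrite -CintegralZ// -CintegralD//; last first.
  have -> : (fun t => a * (f t * Num.conj (g t))) =
            (fun t => (a *: f) t * Num.conj (g t)).
    by apply/funext => t; rewrite mulrA.
  exact: CintegrableM.
by congr Cintegral; apply/funext => t; rewrite /= mulrDl mulrA.
Qed.

Lemma dotL2T_linearr u : linear_for (Num.conj \; *%R) (dotL2T u).
Proof.
move=> a v w; rewrite dotL2TC dotL2T_linearl rmorphD rmorphM /=.
by rewrite -!dotL2TC.
Qed.

Lemma dotL2T_gt0 u : u != 0 -> 0 < dotL2T u u.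
Proof.
elim/quotW: u => f f0; rewrite dotL2T_pi /dotfun /Cintegral.
under [X in _ +i* X]eq_Rintegral do
  rewrite imCM reC_conj imC_conj mulrN mulrC addNr.
rewrite Rintegral_cst// mul0r ltcR.
pose h t := reC (f t) ^+ 2 + imC (f t) ^+ 2.
have hE t : reC (f t * Num.conj (f t)) = h t.
  by rewrite reCM reC_conj imC_conj mulrN opprK -!expr2.
have h0 t : 0 <= h t by rewrite addr_ge0// sqr_ge0.
under eq_Rintegral do rewrite hE.
have [ih _] := CintegrableM f f.
have {}ih : mu.-integrable setT (EFin \o h).
  by apply: eq_integrable ih => // t _; rewrite /= hE.
rewrite lt0r Rintegral_ge0// andbT; apply: contra f0 => /eqP hI.
have mh := measurable_int _ ih.
have <- : \pi_L2T 0 = 0 by rewrite raddf0.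
apply/L2T_eqP.
have : (\int[mu]_t `|(h t)%:E| = 0)%E.
  under eq_integral do rewrite gee0_abs ?lee_fin//.
  rewrite -(fineK (integrable_fin_num _ ih))//.
  by congr EFin.
move/(ae_eq_integral_abs mu measurableT mh).
apply: filterS => t /(_ I)/= [] /eqP.
rewrite paddr_eq0 ?sqr_ge0// !sqrf_eq0 => /andP[/eqP a0 /eqP b0].
by apply/eqP; rewrite eq_complex/= a0 b0 !eqxx.
Qed.

HB.instance Definition _ := bilinear_isBilinear.Build R[i] L2T L2T R[i]
  *%R (Num.conj \; *%R) dotL2T (dotL2T_linearl, dotL2T_linearr).
HB.instance Definition _ := isHermitianSesquilinear.Build R[i] L2T
  false Num.conj dotL2T dotL2T_herm.
HB.instance Definition _ := isDotProduct.Build R[i] L2T dotL2T dotL2T_gt0.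

Lemma Lfun2_bounded (f : R -> R) : continuous f -> (forall t, `|f t| <= 1) ->
  f \in Lfun mu 2%:E.
Proof.
move=> cf f1; have mf : measurable_fun setT f by exact: continuous_measurable_fun.
rewrite inE; apply/andP; split; rewrite inE//=.
rewrite /finite_norm unlock poweR_lty//.
apply: (@le_lt_trans _ _ (\int[mu]_t (cst 1%E t))%E).
  apply: ge0_le_integral => //=.
  - apply/measurable_EFinP; apply: (@measurableT_comp _ _ _ _ _ _ (@powR R ^~ 2)) => //.
    exact: measurableT_comp.
  - by move=> t _; rewrite lee_fin powR_mulrn// exprn_ile1.
rewrite integral_cst// mul1e.
by rewrite (le_lt_trans (probability_le1 mu measurableT))// ltry.
Qed.

(* z ^ n at the point z = exp (i t). *)
Definition circle_pow (n : int) (t : R) : R[i] := cos (n%:~R * t) +i* sin (n%:~R * t).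

Lemma circle_pow_sqint n : circle_pow n \in sqint.
Proof.
apply/andP; split; apply: Lfun2_bounded.
- move=> t; apply: continuous_comp; first exact: mulrl_continuous.
  exact: continuous_cos.
- by move=> t; rewrite ler_norml cos_geN1 cos_le1.
- move=> t; apply: continuous_comp; first exact: mulrl_continuous.
  exact: continuous_sin.
- by move=> t; rewrite ler_norml sin_geN1 sin_le1.
Qed.

Definition zpow (n : int) : L2T := \pi_L2T (MkL2fun (circle_pow_sqint n)).

End L2circle.

Section Operators.
Variables (C : numClosedFieldType) (U : lmodType C) (form : {dot U for Num.conj}).

Definition hilbert_norm (u : U) : C := sqrtC (form u u).

(* The order of C only compares numbers with real difference, so K and e below
   are real. *)
Definition bounded_op (A : U -> U) :=
  exists2 K : C, 0 <= K & forall u, hilbert_norm (A u) <= K * hilbert_norm u.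

Definition closed_subspace (M : set U) :=
  [/\ M 0,
      forall (a : C) u v, M u -> M v -> M (a *: u + v) &
      forall u, (forall e : C, 0 < e -> exists2 v, M v & hilbert_norm (u - v) < e) -> M u].

Definition ortho_compl (M : set U) : set U :=
  [set u | forall v, M v -> form u v = 0].

Definition invariant_under (A : U -> U) (M : set U) := A @` M `<=` M.

(* M and its orthogonal complement are both invariant under A; for bounded A on
   a Hilbert space this is invariance of M under A and its adjoint. *)
Definition reducing (A : U -> U) (M : set U) :=
  [/\ closed_subspace M, invariant_under A M & invariant_under A (ortho_compl M)].

Definition irreducible (A : U -> U) :=
  forall M, reducing A M -> M = [set 0] \/ M = setT.
End Operators.

Section DirectSum.
Variables (C : numClosedFieldType) (U V : lmodType C).
Variables (fU : {dot U for Num.conj}) (fV : {dot V for Num.conj}).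

Definition dsum_dot (u v : U * V) : C := fU u.1 v.1 + fV u.2 v.2.

Lemma dsum_dot_linearl v : linear_for *%R (dsum_dot^~ v).
Proof.
by move=> a u w; rewrite /dsum_dot/= !linearDl/= !linearZl_LR/= mulrDr addrACA.
Qed.

Lemma dsum_dot_linearr u : linear_for (Num.conj \; *%R) (dsum_dot u).
Proof.
by move=> a v w; rewrite /dsum_dot/= !linearD/= !linearZ/= mulrDr addrACA.
Qed.

Lemma dsum_dot_herm u v : dsum_dot u v = (-1) ^+ false * Num.conj (dsum_dot v u).
Proof.
rewrite expr0 mul1r /dsum_dot rmorphD (hermC fU u.1) (hermC fV u.2).
by rewrite !expr0 !mul1r.
Qed.

Lemma dsum_dot_gt0 u : u != 0 -> 0 < dsum_dot u u.
Proof.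
case: u => u v; rewrite xpair_eqE negb_and /dsum_dot/= => /orP[h|h].
  by rewrite ltr_wpDr// ?dnorm_ge0// neq0_dnorm_gt0.
by rewrite ltr_wpDl// ?dnorm_ge0// neq0_dnorm_gt0.
Qed.

HB.instance Definition _ := bilinear_isBilinear.Build C (U * V)%type (U * V)%type C
  *%R (Num.conj \; *%R) dsum_dot (dsum_dot_linearl, dsum_dot_linearr).
HB.instance Definition _ := isHermitianSesquilinear.Build C (U * V)%type
  false Num.conj dsum_dot dsum_dot_herm.
HB.instance Definition _ := isDotProduct.Build C (U * V)%type dsum_dot dsum_dot_gt0.
End DirectSum.

(* The operator matrix [A11, A12; A21, A22] acting on column vectors. *)
Definition block_op (W : nmodType) (A11 A12 A21 A22 : W -> W) (u : W * W) : W * W :=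
  (A11 u.1 + A12 u.2, A21 u.1 + A22 u.2).

Definition shift_weight (R : realType) (lambda : R) (s : R[i]) (n : int) : R[i] :=
  (n%:~R + ((1 + lambda) / 2)%:C + s) / (n%:~R + ((1 + lambda) / 2)%:C - s).

(* Main.v *)
(* A reducing subspace M has an orthogonal projection P (L^2 is complete), and P commutes with T and T^*.
   With respect to the orthonormal family z^n (+) 0, 0 (+) z^n, the operator T is a shift with invertible 2x2 weights
   T_n = [[w_n, b_n], [0, 1]], b_n = alpha (w_n - 1), so the blocks P_mn satisfy P_(m+1,n+1) T_n = T_m P_mn and
   T_m^* P_(m+1,n+1) = P_mn T_n^*.  Hence P_mn intertwines T_n^* T_n with T_m^* T_m, which have determinant 1 and
   traces 2 + |b_n|^2, 2 + |b_m|^2; the numbers a_n = n + (1 + lambda) / 2 satisfy |b_n| = |b_m| only if a_n = +-a_m,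
   and this cannot hold for both (m, n) and (m - 1, n - 1) unless m = n.  So P is block diagonal.  P_11 commutes with
   T_1^* T_1 and with T_0 T_0^*, which do not commute with each other since a_0 + a_1 <> 0; so P_11 is scalar, then
   every P_nn is the same scalar and P is 0 or 1.

   Completeness of the trigonometric system: if all Fourier coefficients of G vanish then G is orthogonal to
   (1 - q^n)^(2^n) for every trigonometric polynomial q.  For q = (1 + cos (t - a)) / (2 (1 + cos d)) these functions
   tend boundedly to the indicator of the complement of the arc of radius d around a; so G has integral 0 over small
   arcs, and Lebesgue's differentiation theorem gives G = 0 almost everywhere. *)
Require Import Defs.
From mathcomp Require Import all_boot all_order all_algebra.
From mathcomp Require Import all_classical all_reals all_analysis.
From mathcomp Require Import measurable_realfun ring_quotient sesquilinear.
From mathcomp Require Import ring lra.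
From mathcomp.real_closed Require Import complex.
Set Implicit Arguments.
Unset Strict Implicit.
Unset Printing Implicit Defensive.
Import Order.TTheory GRing.Theory Num.Theory.
Import numFieldNormedType.Exports.
Local Open Scope ring_scope.
Local Open Scope classical_set_scope.
Local Open Scope complex_scope.

(** * Riesz-Fischer: completeness of real L^2 over a probability measure *)

Section riesz_fischer.
Context d (T : measurableType d) (R : realType) (mu : probability T R).

Lemma Lfun2P (f : T -> R) :
  f \in Lfun mu 2%:E <->
  measurable_fun setT f /\ (\int[mu]_t ((f t) ^+ 2)%:E < +oo)%E.
Proof.
have E : (\int[mu]_x (`|f x| `^ 2)%:E = \int[mu]_t ((f t) ^+ 2)%:E)%E.
  by apply: eq_integral => x _; rewrite powR_mulrn// -normrX ger0_norm// sqr_ge0.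
split.
  move=> fL; split; first by move: fL; rewrite inE => /andP[]; rewrite inE.
  have /integrableP[_] := Lfun2_integrable_sqr fL.
  by under eq_integral do rewrite /= ger0_norm ?sqr_ge0//.
move=> [mf ioo]; rewrite inE; apply/andP; split; rewrite inE//=.
by rewrite /finite_norm unlock poweR_lty// E.
Qed.

(** The increments form an absolutely convergent series whose partial sums telescope to
    [u n - u 0]. *)
Lemma cvg_of_summable_increments (u : nat -> R) :
  (\sum_(0 <= k <oo) (`|u k.+1 - u k|)%:E < +oo)%E -> cvgn u.
Proof.
move=> soo.
have : cvgn (series (fun k => u k.+1 - u k)).
  apply: normed_cvg.
  apply: nondecreasing_is_cvgn.
    by apply: nondecreasing_series => *; exact: normr_ge0.
  exists (fine (\sum_(0 <= k <oo) (`|u k.+1 - u k|)%:E)%E) => _ [n _ <-].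
  rewrite -lee_fin fineK.
    rewrite /series /= -sumEFin.
    by apply: nneseries_lim_ge => k _; rewrite lee_fin.
  by rewrite ge0_fin_numE// nneseries_ge0// => k _ _; rewrite lee_fin.
move=> cs; suff -> : u = fun n => u 0%N + series (fun k => u k.+1 - u k) n.
  by apply: is_cvgD => //; exact: is_cvg_cst.
apply/funext => n; rewrite /series /= telescope_sumr// addrCA subrr addr0//.
Qed.

Lemma limn_einf_le (u : nat -> \bar R) (c : \bar R) :
  (forall n, (u n <= c)%E) -> (limn_einf u <= c)%E.
Proof.
move=> uc; rewrite limn_einf_lim; apply: lime_le; first exact: is_cvg_einfs.
by apply: nearW => n; apply: (le_trans _ (uc n)); apply: ereal_inf_lbound; exists n => //=.
Qed.

(** The geometric rate makes the L^1 norms of the increments summable, so [g n] converges almost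
    everywhere; Fatou's lemma then carries the L^2 bounds over to the pointwise limit. *)
Lemma Lfun2_complete (g : nat -> T -> R) :
  (forall n, g n \in Lfun mu 2%:E) ->
  (forall n m, (n <= m)%N ->
    (\int[mu]_t ((g m t - g n t) ^+ 2)%:E <= (4^-1 ^+ n)%:E)%E) ->
  exists2 h, h \in Lfun mu 2%:E &
    forall n, (\int[mu]_t ((h t - g n t) ^+ 2)%:E <= (4^-1 ^+ n)%:E)%E.
Proof.
move=> gL gC.
have mg n : measurable_fun setT (g n) by have /Lfun2P[] := gL n.
pose dl k t := `|g k.+1 t - g k t|.
have mdl k : measurable_fun setT (dl k).
  by apply: measurableT_comp => //; exact: measurable_funB.
(* AM-GM: [2 |x| <= 2^k x^2 + 2^-k] *)
have idl k : (\int[mu]_t (dl k t)%:E <= (2 / (2 ^ k.+1)%:R)%:E)%E.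
  have c0 : 0 < 2^-1 ^+ k :> R by rewrite exprn_gt0// invr_gt0.
  have c1 : 0 < 2 ^+ k :> R by rewrite exprn_gt0.
  have cc : 2 ^+ k * 2^-1 ^+ k = 1 :> R by rewrite -exprMn divff// expr1n.
  have c4 : 4^-1 ^+ k = 2^-1 ^+ k * 2^-1 ^+ k :> R.
    by rewrite -exprMn; congr (_ ^+ _); lra.
  have -> : 2 / (2 ^ k.+1)%:R = 2^-1 ^+ k :> R.
    by rewrite natrX exprS invfM mulrA divff// mul1r -exprVn.
  apply: (@le_trans _ _ (\int[mu]_t
     ((2 ^+ k / 2)%:E * ((g k.+1 t - g k t) ^+ 2)%:E + (2^-1 ^+ k / 2)%:E))%E).
    apply: ge0_le_integral => //.
    - by move=> t _; rewrite lee_fin normr_ge0.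
    - exact/measurable_EFinP.
    - apply: emeasurable_funD => //; apply/measurable_EFinP.
      apply: measurable_funM => //; apply: measurable_funX.
      exact: measurable_funB.
    - move=> t _; rewrite -EFinM -EFinD lee_fin /dl.
      rewrite -(real_normK (num_real (g k.+1 t - g k t))).
      set x := `|_|; have := sqr_ge0 (2 ^+ k * x - 1).
      move: cc c0 c1; set a := 2 ^+ k; set b := 2^-1 ^+ k => cc c0 c1 h.
      suff : 0 <= a * x ^+ 2 - 2 * x + b by nra.
      have -> : a * x ^+ 2 - 2 * x + b = b * (a * x - 1) ^+ 2.
        transitivity ((a * b) * a * x ^+ 2 - 2 * (a * b) * x + b); last by ring.
        by rewrite cc; ring.
      by apply: mulr_ge0 => //; exact: ltW.
  have mq : measurable_fun setT (fun t => ((g k.+1 t - g k t) ^+ 2)%:E).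
    by apply/measurable_EFinP; apply: measurable_funX; exact: measurable_funB.
  rewrite ge0_integralD//=; last 2 first.
  - by move=> t _; rewrite -EFinM lee_fin mulr_ge0 ?sqr_ge0// divr_ge0// ltW.
  - exact: measurable_funeM.
  rewrite ge0_integralZl//=; last by move=> t _; rewrite lee_fin sqr_ge0.
  rewrite integral_cst// [X in (_ + _ * X)%E]probability_setT mule1.
  apply: (@le_trans _ _ ((2 ^+ k / 2)%:E * (4^-1 ^+ k)%:E + (2^-1 ^+ k / 2)%:E)%E).
    by apply: leeD => //; apply: lee_wpmul2l; rewrite ?gC// lee_fin ltW// divr_gt0.
  rewrite -EFinM -EFinD lee_fin c4.
  move: cc; set a := 2 ^+ k; set b := 2^-1 ^+ k => cc.
  have -> : a / 2 * (b * b) = (a * b) * b / 2 by ring.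
  by rewrite cc; lra.
(* The total variation of the sequence at [t]; being integrable it is finite almost everywhere,
   which gives pointwise convergence there. *)
pose S t := (\sum_(0 <= k <oo) (dl k t)%:E)%E.
have iS : mu.-integrable setT S.
  have S0 t : (0 <= S t)%E.
    by apply: nneseries_ge0 => k _ _; rewrite lee_fin normr_ge0.
  apply/integrableP; split.
    apply: ge0_emeasurable_sum => [k t _ _|k _]; last exact/measurable_EFinP.
    by rewrite lee_fin normr_ge0.
  under eq_integral do rewrite gee0_abs//.
  rewrite integral_nneseries//; last 2 first.
  - by move=> k; exact/measurable_EFinP.
  - by move=> k t _; rewrite lee_fin normr_ge0.
  apply: (@le_lt_trans _ _ (\sum_(0 <= k <oo) (2 / (2 ^ k.+1)%:R)%:E)%E).
    by apply: lee_nneseries => // k _ _; apply: integral_ge0 => t _; rewrite lee_fin normr_ge0.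
  have -> : (\sum_(0 <= k <oo) (2 / (2 ^ k.+1)%:R)%:E)%E = 2%:E :> \bar R.
    have /cvg_lim := @cvg_geometric_eseries_half R 2 0.
    rewrite expr0 divr1 => <- //; congr (lim (_ @ \oo)); apply/funext => n; rewrite /eseries/=.
    by apply: eq_bigr => k _; rewrite addn1.
  exact: ltry.
(* The upper limit is measurable without knowledge of the set of convergence, and it agrees with the
   limit almost everywhere. *)
pose h t := fine (limn_esup (fun n => (g n t)%:E)).
have mh : measurable_fun setT h.
  apply: (@measurableT_comp _ _ _ _ _ _ (@fine R)) => //.
  by apply: measurable_fun_limn_esup => n; exact/measurable_EFinP.
have gh : {ae mu, forall t, g ^~ t @ \oo --> h t}.
  have := integrable_ae measurableT iS.
  apply: filterS => t /(_ I) Sfin.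
  have /cvg_ex[l gl] : cvgn (g ^~ t).
    by apply: cvg_of_summable_increments; rewrite -ge0_fin_numE// nneseries_ge0.
  suff -> : h t = l by [].
  rewrite /h; have /cvg_limn_einf_sup[_ ->//] : (g n t)%:E @[n --> \oo] --> l%:E.
  by apply: cvg_EFin => //; exact: nearW.
have hg n : (\int[mu]_t ((h t - g n t) ^+ 2)%:E <= (4^-1 ^+ n)%:E)%E.
  (* The index is shifted by [n] so that the Cauchy bound holds for every [m], hence for the lower
     limit in Fatou's lemma. *)
  pose f m t := ((g (m + n)%N t - g n t) ^+ 2)%:E.
  have mf m : measurable_fun setT (f m).
    by apply/measurable_EFinP; apply: measurable_funX; exact: measurable_funB.
  have f0 m t : setT t -> (0 <= f m t)%E by rewrite lee_fin sqr_ge0.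
  have := fatou mu measurableT mf f0.
  have -> : (\int[mu]_t limn_einf (f ^~ t) = \int[mu]_t ((h t - g n t) ^+ 2)%:E)%E.
    apply: ae_eq_integral => //.
    - under eq_fun do rewrite -[f^~ _]/(fun m => f m _).
      have -> : (fun t => limn_einf (f^~ t)) = (fun t => - limn_esup (fun m => - f m t))%E.
        apply/funext => t; rewrite -limn_einfN; congr limn_einf.
        by apply/funext => m; rewrite [RHS]/comp oppeK.
      by apply: measurableT_comp => //; apply: measurable_fun_limn_esup => m; exact: measurableT_comp.
    - apply/measurable_EFinP; apply: measurable_funX; exact: measurable_funB.
    - apply: filterS gh => t gt _.
      suff /cvg_limn_einf_sup[->//] : f m t @[m --> \oo] --> ((h t - g n t) ^+ 2)%:E.
      apply: cvg_EFin; first exact: nearW.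
      rewrite /comp /f /=; under eq_fun do rewrite expr2.
      rewrite expr2; have H : (g (m + n)%N t - g n t) @[m --> \oo] --> h t - g n t.
        apply: cvgB; last exact: cvg_cst.
        by move: gt; rewrite -(cvg_shiftn n (g^~ t)).
      exact: cvgM.
  move=> /le_trans; apply; apply: limn_einf_le => m; apply: gC; exact: leq_addl.
exists h => //.
have -> : h = fun t => (h t - g 0%N t) + g 0%N t by apply/funext => t; rewrite subrK.
have [_ /(_ 1 (fun t => h t - g 0%N t) (g 0%N))] := Lfun_submod_closed mu (lee1n 2).
rewrite scale1r; apply => //; apply/Lfun2P; split; first exact: measurable_funB.
by apply: (le_lt_trans (hg 0%N)); rewrite ltry.
Qed.

End riesz_fischer.

(** * Polynomials approximating a step at 1/2 *)

Section threshold.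
Context {R : realType}.
Implicit Types q : R.

Lemma bernoulli_ge (x : R) m : -1 <= x -> 1 + m%:R * x <= (1 + x) ^+ m.
Proof.
move=> x1; elim: m => [|m IH]; first by rewrite mul0r addr0 expr0.
rewrite exprS; apply: (@le_trans _ _ ((1 + x) * (1 + m%:R * x))).
  rewrite -natr1 -subr_ge0.
  have -> : (1 + x) * (1 + m%:R * x) - (1 + (m%:R + 1) * x) = m%:R * x ^+ 2 by ring.
  by rewrite mulr_ge0// sqr_ge0.
by apply: ler_wpM2l => //; rewrite -lerBlDl sub0r.
Qed.

(** With [x = q ^+ n] and [m = 2 ^ n] this is [(1 - x) ^+ m], whose size is governed by
    [m x = (2 q) ^+ n]. On [0, 1] it therefore separates [q < 1/2] from [q > 1/2]. These are the
    polynomials of the elementary proof of the Stone-Weierstrass theorem. *)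
Definition threshold n q := (1 - q ^+ n) ^+ (2 ^ n).

Lemma threshold_itv n q : 0 <= q <= 1 -> 0 <= threshold n q <= 1.
Proof.
move=> /andP[q0 q1].
have /andP[a b] : 0 <= q ^+ n <= 1 by rewrite exprn_ge0//= exprn_ile1.
by rewrite /threshold exprn_ge0 ?subr_ge0//= exprn_ile1// ?subr_ge0// gerBl.
Qed.

Lemma threshold_cvg1 q : 0 <= q < 2^-1 -> threshold n q @[n --> \oo] --> (1 : R).
Proof.
move=> /andP[q0 q1]; have q2 : `|2 * q| < 1 by rewrite ger0_norm; lra.
apply: (@squeeze_cvgr _ _ _ _ (fun n => 1 - (2 * q) ^+ n) (fun=> 1)).
- apply: nearW => n; apply/andP; split; last first.
    by have /andP[] : 0 <= threshold n q <= 1 by apply: threshold_itv; lra.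
  rewrite /threshold; have := @bernoulli_ge (- q ^+ n) (2 ^ n).
  rewrite mulrN natrX -exprMn; apply.
  by rewrite lerN2 exprn_ile1//; lra.
- rewrite -[X in _ --> X]subr0; apply: cvgB; first exact: cvg_cst.
  exact: cvg_expr.
- exact: cvg_cst.
Qed.

(** With [x = q ^+ n] and [m = 2 ^ n], the product of [(1 - x) ^+ m] and [(1 + x) ^+ m] is at most
    1, while Bernoulli's inequality bounds the second factor below by [(2 q) ^+ n]. *)
Lemma threshold_cvg0 q : 2^-1 < q <= 1 -> threshold n q @[n --> \oo] --> (0 : R).
Proof.
move=> /andP[q0 q1]; have q20 : 0 < 2 * q by lra.
have q2 : `|(2 * q)^-1| < 1.
  by rewrite gtr0_norm ?invr_gt0// invf_lt1//; lra.
apply: (@squeeze_cvgr _ _ _ _ (fun=> 0) (fun n => (2 * q)^-1 ^+ n)).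
- apply: nearW => n.
  have /andP[-> _] : 0 <= threshold n q <= 1 by apply: threshold_itv; lra.
  have x0 : 0 < q ^+ n by rewrite exprn_gt0//; lra.
  have x1 : q ^+ n <= 1 by rewrite exprn_ile1//; lra.
  have B : (2 * q) ^+ n <= (1 + q ^+ n) ^+ (2 ^ n).
    rewrite exprMn -natrX.
    apply: le_trans (@bernoulli_ge (q ^+ n) (2 ^ n) _); last by lra.
    by rewrite lerDr.
  have c0 : 0 < (2 * q) ^+ n by rewrite exprn_gt0.
  rewrite exprVn -[leRHS]mul1r ler_pdivlMr//.
  apply: (@le_trans _ _ (threshold n q * (1 + q ^+ n) ^+ (2 ^ n))).
    by apply: ler_wpM2l => //; rewrite /threshold exprn_ge0// subr_ge0.
  rewrite /threshold -exprMn exprn_ile1//.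
    by rewrite mulr_ge0//; lra.
  by rewrite -subr_sqr expr1n gerBl sqr_ge0.
- exact: cvg_cst.
- exact: cvg_expr.
Qed.

End threshold.

(** * Real functions whose Fourier coefficients all vanish, and their multipliers *)

Section trig_null.
Context {R : realType}.
Local Notation mu := (circle_measure R).
Implicit Types G H : R -> R.

Lemma integrableM_le1 G H : mu.-integrable setT (EFin \o G) ->
  measurable_fun setT H -> (forall t, `|H t| <= 1) ->
  mu.-integrable setT (EFin \o (fun t => G t * H t)).
Proof.
move=> iG mH H1; have /measurable_EFinP mG := measurable_int _ iG.
apply: le_integrable iG => //.
  by apply/measurable_EFinP; exact: measurable_funM.
by move=> t _; rewrite /= lee_fin normrM ler_piMr.
Qed.

Lemma measurable_cos_affine (a b : R) :
  measurable_fun setT (fun t : R => cos (a * t + b)).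
Proof.
apply: continuous_measurable_fun => t; apply: continuous_comp; last exact: continuous_cos.
by apply: cvgD; [exact: mulrl_continuous|exact: cvg_cst].
Qed.

(** The free phase [b] treats cosines and sines at once and keeps the condition stable under
    translation of the cosine factor. *)
Definition trig_null G := mu.-integrable setT (EFin \o G) /\
  forall (n : int) (b : R), \int[mu]_t (G t * cos (n%:~R * t + b)) = 0.

Lemma integrable_mul_cos G (a b : R) : mu.-integrable setT (EFin \o G) ->
  mu.-integrable setT (EFin \o (fun t => G t * cos (a * t + b))).
Proof.
move=> iG; apply: integrableM_le1 => //; first exact: measurable_cos_affine.
by move=> t; exact: cos_max.
Qed.

Lemma integrable_scale G (c : R) : mu.-integrable setT (EFin \o G) ->
  mu.-integrable setT (EFin \o (fun t => c * G t)).
Proof.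
move=> iG; rewrite (_ : _ \o _ = fun t => c%:E * (G t)%:E)%E; first exact: integrableZl.
by apply/funext => t; rewrite /= EFinM.
Qed.

Lemma integrable_add G H : mu.-integrable setT (EFin \o G) ->
  mu.-integrable setT (EFin \o H) ->
  mu.-integrable setT (EFin \o (fun t => G t + H t)).
Proof.
move=> iG iH; rewrite (_ : _ \o _ = fun t => (G t)%:E + (H t)%:E)%E; first exact: integrableD.
by apply/funext => t; rewrite /= EFinD.
Qed.

Lemma trig_nullD G H : trig_null G -> trig_null H -> trig_null (fun t => G t + H t).
Proof.
move=> [iG G0] [iH H0]; split; first exact: integrable_add.
move=> n b; under eq_Rintegral do rewrite mulrDl.
by rewrite RintegralD//; [rewrite G0 H0 addr0|exact: integrable_mul_cos..].
Qed.

Lemma trig_nullZ c G : trig_null G -> trig_null (fun t => c * G t).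
Proof.
move=> [iG G0]; split; first exact: integrable_scale.
move=> n b; under eq_Rintegral do rewrite -mulrA.
by rewrite RintegralZl//; [rewrite G0 mulr0|exact: integrable_mul_cos].
Qed.

Lemma trig_null_integral0 G : trig_null G -> \int[mu]_t G t = 0.
Proof.
move=> [_ /(_ 0 0) G0]; rewrite -[RHS]G0; apply: eq_Rintegral => t _.
by rewrite mul0r addr0 cos0 mulr1.
Qed.

(** The product formula for cosines turns the extra factor into frequencies [n + 1] and [n - 1] with
    new phases, which are again covered by the hypothesis on [G]. *)
Lemma trig_null_cos G a : trig_null G -> trig_null (fun t => G t * cos (t - a)).
Proof.
move=> [iG G0].
have ca : (fun t => G t * cos (t - a)) = fun t => G t * cos (1 * t + - a).
  by apply/funext => t; rewrite mul1r.
split; first by rewrite ca; exact: integrable_mul_cos.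
move=> n b.
transitivity (\int[mu]_t (2^-1 * (G t * cos ((n + 1)%:~R * t + (b - a))) +
                         2^-1 * (G t * cos ((n - 1)%:~R * t + (b + a))))).
  apply: eq_Rintegral => t _.
  have -> : (n + 1)%:~R * t + (b - a) = (n%:~R * t + b) + (t - a) by rewrite intrD; ring.
  have -> : (n - 1)%:~R * t + (b + a) = (n%:~R * t + b) - (t - a) by rewrite intrB; ring.
  by move: (n%:~R * t + b) (t - a) => x y; rewrite cosB cosD; field.
rewrite RintegralD//; [|by apply: integrable_scale; exact: integrable_mul_cos..].
rewrite !RintegralZl//; [|exact: integrable_mul_cos..].
by rewrite !G0 !mulr0 addr0.
Qed.

(** Multipliers form an algebra containing the constants and [cos (t - a)], hence all polynomials in
    [cos (t - a)]; no expansion into Fourier modes has to be written down. *)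
Definition trig_multiplier H := forall G, trig_null G -> trig_null (fun t => G t * H t).

Lemma trig_multiplier_cst c : trig_multiplier (cst c).
Proof.
by move=> G /(trig_nullZ c); under eq_fun do rewrite mulrC.
Qed.

Lemma trig_multiplierD H K : trig_multiplier H -> trig_multiplier K ->
  trig_multiplier (fun t => H t + K t).
Proof.
move=> h k G G0; under eq_fun do rewrite mulrDr.
by apply: trig_nullD; [exact: h|exact: k].
Qed.

Lemma trig_multiplierM H K : trig_multiplier H -> trig_multiplier K ->
  trig_multiplier (fun t => H t * K t).
Proof.
by move=> h k G G0; under eq_fun do rewrite mulrA; apply: k; exact: h.
Qed.

Lemma trig_multiplierX H n : trig_multiplier H -> trig_multiplier (fun t => H t ^+ n).
Proof.
move=> h; elim: n => [|n IH].
  by under eq_fun do rewrite expr0; exact: (trig_multiplier_cst 1).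
by under eq_fun do rewrite exprS; exact: trig_multiplierM.
Qed.

Lemma trig_multiplier_threshold n H : trig_multiplier H ->
  trig_multiplier (fun t => threshold n (H t)).
Proof.
move=> h; apply: (@trig_multiplierX (fun t => 1 - H t ^+ n)).
apply: (@trig_multiplierD (cst 1) (fun t => - H t ^+ n)).
  exact: trig_multiplier_cst.
under eq_fun do rewrite -mulN1r.
apply: (@trig_multiplierM (cst (-1)) (fun t => H t ^+ n)).
  exact: trig_multiplier_cst.
exact: trig_multiplierX.
Qed.

End trig_null.

(** * Circle measure against Lebesgue measure on [0, 2 pi] *)

Section circle_measure_ae.
Context {R : realType}.
Local Notation mu := (circle_measure R).
Local Notation leb := (@lebesgue_measure R).

Local Notation circle_itv := (`[0, (pi : R) *+ 2] : set R).

Lemma circle_measure_dominated A : measurable A -> leb A = 0%E -> mu A = 0%E.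
Proof.
by have /null_content_dominatesP := dominates_uniform_prob (@twopi_gt0 R); apply.
Qed.

Lemma ae_circle_lebesgue (P : R -> Prop) :
  {ae leb, forall t, P t} -> {ae mu, forall t, P t}.
Proof.
move=> [A [mA A0 PA]]; exists A; split => //; exact: circle_measure_dominated.
Qed.

Lemma ae_circle_neq (c : R) : {ae mu, forall t, t <> c}.
Proof.
exists [set c]; split => //.
- by apply: circle_measure_dominated => //; exact: lebesgue_measure_set1.
- by move=> t /= /contrapT.
Qed.

Lemma ae_circle_itv : {ae mu, forall t, 0 <= t <= pi *+ 2}.
Proof.
exists (~` circle_itv); split.
- exact: measurableC.
- by rewrite /= /uniform_prob integral_uniform_pdf setICl integral_set0.
- by move=> t /= h; rewrite in_itv.
Qed.

(** The density formula is applied to the positive and negative parts; integrability makes both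
    integrals finite, so that the constant can be factored out of their difference. *)
Lemma integral_circle (f : R -> \bar R) : mu.-integrable setT f ->
  (\int[mu]_t f t = ((pi *+ 2)^-1)%R%:E * \int[leb]_(t in circle_itv) f t)%E.
Proof.
move=> fi; have mf := measurable_int _ fi.
have mp : measurable_fun setT (f^\+)%E by exact: measurable_funepos.
have mn : measurable_fun setT (f^\-)%E by exact: measurable_funeneg.
rewrite integralE (integral_uniform _ mp)//; rewrite (integral_uniform _ mn)// subr0.
rewrite -muleBr//; first by rewrite -integralE.
have c0 : (0 < ((pi *+ 2)^-1)%R%:E :> \bar R)%E by rewrite lte_fin invr_gt0 twopi_gt0.
have fin (g : R -> \bar R) : (forall t, (0 <= g t)%E) -> measurable_fun setT g ->
    (\int[mu]_t g t < +oo)%E -> (\int[leb]_(t in circle_itv) g t)%E \is a fin_num.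
  move=> g0 mg; rewrite integral_uniform// subr0 ge0_fin_numE ?integral_ge0//.
  by case: (integral _ _ _) => [r _| |]; rewrite ?ltry ?gt0_muley ?ltNyr// ltxx.
apply: fin_num_adde_defl; rewrite fin_numN; apply: fin => //.
exact: integral_funeneg_lt_pinfty.
Qed.

Lemma integrable_circle_lebesgue (G : R -> R) : mu.-integrable setT (EFin \o G) ->
  leb.-integrable circle_itv (EFin \o G).
Proof.
move=> /integrableP[mG fG]; apply/integrableP; split.
  exact: measurable_funTS.
move: fG; rewrite integral_uniform//; last exact: measurableT_comp.
rewrite subr0; have c0 : (0 < ((pi *+ 2)^-1)%R%:E :> \bar R)%E.
  by rewrite lte_fin invr_gt0 twopi_gt0.
have : (0 <= \int[leb]_(t in circle_itv) `|(EFin \o G) t|)%E by exact: integral_ge0.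
by case: (integral _ _ _) => // [r _ _|_]; rewrite ?ltry// gt0_muley.
Qed.

End circle_measure_ae.

(** * Vanishing of integrals over arcs *)

Section arcs.
Context {R : realType}.
Local Existing Instance ae_circle.
Local Notation mu := (circle_measure R).
Local Notation leb := (@lebesgue_measure R).
Implicit Types G : R -> R.

(** Cosine decreases on [0, pi]; beyond pi, [x] is reflected to [2 pi - x], which still exceeds [d]
    by the upper bound on [x]. *)
Lemma cos_arc (x d : R) : 0 < d < pi / 2 -> 0 <= x < pi *+ 2 - d ->
  (x < d -> cos d < cos x) /\ (d < x -> cos x < cos d).
Proof.
move=> /andP[d0 d1] /andP[x0 x1].
have p0 := pi_gt0 R.
have [xp|xp] := leP x pi.
  by rewrite !ltr_cos// in_itv/= ?x0 ?xp// (ltW d0)/=; lra.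
have -> : cos x = cos (pi *+ 2 - x) by rewrite -cosN -[in LHS]cosD2pi addrC.
rewrite !ltr_cos ?in_itv/=; [|by apply/andP; split; lra..].
by split; lra.
Qed.

Lemma trig_null_eintegral0 G : trig_null G -> (\int[mu]_t (G t)%:E = 0)%E.
Proof.
move=> nG; have [iG _] := nG; rewrite -(fineK (integrable_fin_num measurableT iG)).
by have := trig_null_integral0 nG; rewrite /Rintegral => ->.
Qed.

(** The multiplied functions [G * threshold n q] all have integral 0 and converge dominatedly to [G]
    off the arc; since the integral of [G] itself is 0, so is the part over the arc. The bounds on
    [a] keep the arc inside (0, 2 pi). *)
Lemma trig_null_arc G (a d : R) : trig_null G -> 0 < d < pi / 2 ->
  d < a < pi *+ 2 - d -> (\int[mu]_(t in ball a d) (G t)%:E = 0)%E.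
Proof.
move=> nG d12 ad; have [iG _] := nG.
have /andP[d0 d1] := d12; have /andP[a0 a1] := ad.
have p0 := pi_gt0 R.
have cd : 0 < cos d by apply: cos_gt0_pihalf; lra.
(* The normalisation places the value 1/2 exactly where [cos (t - a) = cos d]; [q <= 1] holds
   because [cos d] is positive. *)
pose q t := (1 + cos (t - a)) * (2 * (1 + cos d))^-1.
have c0 : 0 < 2 * (1 + cos d) by lra.
have q01 t : 0 <= q t <= 1.
  rewrite /q divr_ge0 ?ler_pdivrMr//=; have := cos_le1 (t - a); have := cos_geN1 (t - a); lra.
have qlt t : (q t < 2^-1) = (cos (t - a) < cos d).
  by rewrite /q ltr_pdivrMr//; apply/idP/idP; lra.
have qgt t : (2^-1 < q t) = (cos d < cos (t - a)).
  by rewrite /q ltr_pdivlMr//; apply/idP/idP; lra.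
have mq : trig_multiplier q.
  apply: (@trig_multiplierM _ (fun t => 1 + cos (t - a)) (cst _)); last exact: trig_multiplier_cst.
  apply: (@trig_multiplierD _ (cst 1)); first exact: trig_multiplier_cst.
  by move=> H; exact: trig_null_cos.
pose F n t := G t * threshold n (q t).
have nF n : trig_null (F n) by exact: trig_multiplier_threshold.
pose L t := G t * (1 - \1_(ball a d) t).
have mG : measurable_fun setT G by apply/measurable_EFinP; exact: measurable_int iG.
have mL : measurable_fun setT (EFin \o L).
  by apply/measurable_EFinP; apply: measurable_funM => //; apply: measurable_funB => //;
    apply: measurable_indic; exact: measurable_ball.
have FL : {ae mu, forall t, setT t -> (EFin \o F n) t @[n --> \oo] --> (EFin \o L) t}.
  (* The two endpoints of the arc, where [q = 1/2] and the thresholds have no known limit, form a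
     null set. *)
  apply: filterS3 ae_circle_itv (ae_circle_neq (a + d)) (ae_circle_neq (a - d)) => t /andP[t0 t1] tp tm _.
  apply: cvg_EFin; first exact: nearW.
  apply: cvgM; first exact: cvg_cst.
  have xd : `|t - a| != d by apply/eqP; case: ger0P => _ ?; [apply: tp|apply: tm]; lra.
  have x2 : 0 <= `|t - a| < pi *+ 2 - d.
    by rewrite normr_ge0/=; case: ger0P => _; lra.
  have [lt_arc gt_arc] := @cos_arc `|t - a| d d12 x2; rewrite cos_norm in lt_arc gt_arc.
  have /andP[q0 q1] := q01 t.
  rewrite indicE; have [/set_mem|/negP] := boolP (t \in (ball a d : set R)).
    rewrite /ball/= distrC => /lt_arc; rewrite -qgt => h.
    by rewrite subrr; apply: threshold_cvg0; rewrite h.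
  rewrite inE /ball/= distrC => /negP; rewrite -leNgt le_eqVlt eq_sym (negbTE xd)/=.
  move=> /gt_arc; rewrite -qlt => h.
  by rewrite subr0; apply: threshold_cvg1; rewrite q0.
have Fle : {ae mu, forall t n, setT t -> (`|(EFin \o F n) t| <= (abse \o (EFin \o G)) t)%E}.
  apply: aeW => t n _; rewrite /= lee_fin normrM ler_piMr//.
  by rewrite ger0_norm; have /andP[] := @threshold_itv _ n _ (q01 t).
have [iL _ IL] := dominated_convergence measurableT
  (fun n => measurable_int _ (nF n).1) mL FL (integrable_abse iG) Fle.
have L0 : (\int[mu]_t (L t)%:E = 0)%E.
  have H := cvg_lim (@ereal_hausdorff R) IL; rewrite -H; apply: cvg_lim => //.
  rewrite (_ : [sequence _]_n = fun=> 0%E); first exact: cvg_cst.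
  apply/funext => n; exact: trig_null_eintegral0 (nF n).
rewrite integral_mkcond.
transitivity (\int[mu]_t ((G t)%:E - (L t)%:E))%E; last by rewrite integralB// (trig_null_eintegral0 nG) L0 subee.
apply: eq_integral => t _; rewrite patchE -EFinB /L indicE.
by case: ifPn => _ /=; [rewrite subrr mulr0 subr0|rewrite subr0 mulr1 subrr].
Qed.

End arcs.

(** * From arcs to points by Lebesgue differentiation *)

Section totality.
Context {R : realType}.
Local Existing Instance ae_circle.
Local Notation mu := (circle_measure R).
Local Notation leb := (@lebesgue_measure R).
Local Notation circle_itv := (`[0, (pi : R) *+ 2] : set R).
Implicit Types G : R -> R.

(** When the integral over a ball vanishes, the mean of [G - G x] there is [- G x], so [|G x|] is at
    most the mean deviation, which tends to 0 at a Lebesgue point. *)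
Lemma lebesgue_pt_eq0 G (x : R) : locally_integrable setT G -> lebesgue_pt G x ->
  (\forall r \near (0 : R)^'+, (\int[leb]_(t in ball x r) (G t)%:E = 0)%E) -> G x = 0.
Proof.
move=> [mG _ liG] Gx iG0.
suff H : \forall r \near (0 : R)^'+, (`|G x|%:E <= davg G x r)%E.
  have : (`|G x|%:E <= 0%:E)%E.
    have -> : 0%:E = lim (davg G x r @[r --> (0 : R)^'+]) by apply/esym/cvg_lim.
    apply: lime_ge => //; by apply/cvg_ex; exists 0%E.
  by rewrite lee_fin normr_le0 => /eqP.
near=> r.
have r0 : 0 < r by near: r; exact: nbhs_right_gt.
have ir : (\int[leb]_(t in ball x r) (G t)%:E = 0)%E by near: r.
have lr : leb (ball x r) = (r *+ 2)%:E by rewrite lebesgue_measure_ball// ltW.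
have mb : measurable (ball x r) by exact: measurable_ball.
have iGb : leb.-integrable (ball x r) (EFin \o G).
  apply: (@integrableS _ _ _ leb (closed_ball x r : set R)) => //.
  - exact: measurable_closed_ball.
  - exact: subset_closed_ball.
  apply/integrableP; split; first by apply/measurable_EFinP; exact: measurable_funTS.
  by apply: liG => //; exact: closed_ballR_compact.
have icb : leb.-integrable (ball x r) (EFin \o cst (G x)).
  apply/integrableP; split; first by apply/measurable_EFinP; exact: measurable_cst.
  rewrite (_ : (fun t => _) = cst `|(G x)%:E|%E)// integral_cst// [X in (_ * X)%E]lr.
  by rewrite -EFinM ltry.
rewrite /davg /iavg lr.
have r2 : 0 < r *+ 2 by rewrite pmulrn_lgt0.
rewrite inver gt_eqF//. rewrite -(@lee_pmul2l _ (r *+ 2)%:E)//= ?muleA -?EFinM ?divff ?gt_eqF// mul1e.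
have -> : (r *+ 2 * `|G x|)%:E = `|\int[leb]_(y in ball x r) ((G y)%:E - (G x)%:E)|%E.
  rewrite integralB// ir integral_cst// [X in (_ * X)%E]lr sub0e abseN -EFinM abse_EFin normrM mulrC.
  by rewrite (gtr0_norm r2).
apply: (le_trans (le_abse_integral leb mb _)).
  by apply: emeasurable_funB; [exact: measurable_int iGb|exact: measurable_int icb].
by [].
Unshelve. all: by end_near. Qed.

(** [G] is cut off outside [0, 2 pi] to be locally integrable on the line; at interior points all
    small balls are arcs covered by [trig_null_arc]. *)
Lemma trig_null_ae0 G : trig_null G -> {ae mu, forall t, G t = 0}.
Proof.
move=> nG; have [iG _] := nG.
have iL := integrable_circle_lebesgue iG.
have lG : locally_integrable setT (G \_ circle_itv).
  by apply: integrable_locally_restrict.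
have := ae_circle_lebesgue (lebesgue_differentiation lG).
have H0 := ae_circle_neq (0 : R); have H1 := ae_circle_neq ((pi : R) *+ 2).
have H2 := @ae_circle_itv R.
have H01 : {ae mu, forall t, 0 < t < pi *+ 2}.
  apply: filterS3 H0 H1 H2 => t /eqP t0 /eqP t1 /andP[].
  by rewrite !le_eqVlt eq_sym (negbTE t0) (negbTE t1)/= => -> ->.
apply: filterS2 H01 => t /andP[t0 t1] Lt.
suff : (G \_ circle_itv) t = 0.
  by rewrite patchE mem_set//= in_itv/= !ltW.
apply: lebesgue_pt_eq0 lG Lt _.
near=> r.
have r0 : 0 < r by near: r; exact: nbhs_right_gt.
have r1 : r < pi / 2 by near: r; apply: nbhs_right_lt; rewrite divr_gt0// pi_gt0.
have r2 : r < t by near: r; exact: nbhs_right_lt.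
have r3 : r < pi *+ 2 - t by near: r; apply: nbhs_right_lt; rewrite subr_gt0.
have := @trig_null_arc _ G t r nG; rewrite r0 r1 r2 ltrBrDl -ltrBrDr r3 => /(_ isT isT).
have mb : measurable (ball t r : set R) by exact: measurable_ball.
rewrite integral_mkcond integral_circle; last first.
  apply/(integrable_restrict mu mb measurableT); rewrite setTI.
  exact: integrableS iG.
move=> /eqP; rewrite mule_eq0 eqe invr_eq0 gt_eqF ?twopi_gt0//= => /eqP h.
rewrite integral_mkcond -[RHS]h [in RHS]integral_mkcond.
apply: eq_integral => y _; rewrite !patchE.
by case: ifP; case: ifP.
Unshelve. all: by end_near. Qed.

End totality.

(** * Inner product geometry and the projection theorem *)

Section hilbert.
Context {R : realType} {U : lmodType R[i]} (form : {dot U for Num.conj}).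
Local Notation reC := complex.Re.
Local Notation imC := complex.Im.

(** Real-valued squares of norm and modulus, so that estimates take place in the ordered field [R]
    and not in the partially ordered [R[i]]. *)
Definition sqnorm (u : U) : R := reC (form u u).
Definition sqmod (z : R[i]) : R := reC z ^+ 2 + imC z ^+ 2.

Lemma sqmod_ge0 z : 0 <= sqmod z.
Proof. by rewrite addr_ge0 ?sqr_ge0. Qed.

Lemma sqmod_eq0 z : sqmod z = 0 -> z = 0.
Proof.
case: z => a b /eqP; rewrite /sqmod /= paddr_eq0 ?sqr_ge0// !sqrf_eq0.
by move=> /andP[/eqP-> /eqP->].
Qed.

Lemma sqmodD z w : sqmod (z + w) <= 2 * sqmod z + 2 * sqmod w.
Proof.
case: z w => [a b] [c d]; rewrite /sqmod /=.
by have := sqr_ge0 (a - c); have := sqr_ge0 (b - d); nra.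
Qed.

Lemma mul_conjE (z : R[i]) : z * Num.conj z = (sqmod z)%:C.
Proof. by case: z => a b; rewrite /sqmod /=; apply/eqP; rewrite eq_complex /=; apply/andP; split; apply/eqP; ring. Qed.

Lemma hdotC u v : form u v = Num.conj (form v u).
Proof. by rewrite (hermC form u v) expr0 mul1r. Qed.

Lemma hdotE u : form u u = (sqnorm u)%:C.
Proof.
have := hdotC u u; rewrite /sqnorm; case: (form u u) => a b /eqP.
rewrite eq_complex /= => /andP[_ /eqP h]; congr (_ +i* _).
by lra.
Qed.

Lemma sqnorm_ge0 u : 0 <= sqnorm u.
Proof. by have := dnorm_ge0 form u; rewrite hdotE lecR. Qed.

Lemma sqnorm_eq0 u : sqnorm u = 0 -> u = 0.
Proof. by move=> h; apply/eqP; rewrite -(dnorm_eq0 form) hdotE h. Qed.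

Lemma hdotDl u v w : form (u + v) w = form u w + form v w.
Proof. by rewrite linearDl. Qed.

Lemma hdotDr u v w : form w (u + v) = form w u + form w v.
Proof. by rewrite linearD. Qed.

Lemma hdotZl c u v : form (c *: u) v = c * form u v.
Proof. by rewrite linearZl_LR. Qed.

Lemma hdotZr c u v : form u (c *: v) = Num.conj c * form u v.
Proof. by rewrite linearZ. Qed.

Lemma hdotBl u v w : form (u - v) w = form u w - form v w.
Proof. by rewrite -scaleN1r hdotDl hdotZl mulN1r. Qed.

Lemma hdotBr u v w : form w (u - v) = form w u - form w v.
Proof. by rewrite -scaleN1r hdotDr hdotZr rmorphN1 mulN1r. Qed.

Lemma hdot0l v : form 0 v = 0.
Proof. by rewrite -(scale0r (0 : U)) hdotZl mul0r. Qed.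

Lemma hdot0r v : form v 0 = 0.
Proof. by rewrite hdotC hdot0l rmorph0. Qed.

Lemma sqnormD u v : sqnorm (u + v) = sqnorm u + 2 * reC (form u v) + sqnorm v.
Proof.
rewrite /sqnorm hdotDl !hdotDr !reCD (hdotC v u) reC_conj; ring.
Qed.

Lemma sqnormZ c u : sqnorm (c *: u) = sqmod c * sqnorm u.
Proof.
by rewrite /sqnorm hdotZl hdotZr mulrA mul_conjE reCM /= mul0r subr0.
Qed.

Lemma sqnormN u : sqnorm (- u) = sqnorm u.
Proof. by rewrite -scaleN1r sqnormZ /sqmod /= sqrrN expr1n oppr0 expr0n addr0 mul1r. Qed.

Lemma sqnorm_distC u v : sqnorm (u - v) = sqnorm (v - u).
Proof. by rewrite -sqnormN opprB. Qed.

Lemma sqnorm_parallelogram u v :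
  sqnorm (u + v) + sqnorm (u - v) = 2 * sqnorm u + 2 * sqnorm v.
Proof.
rewrite !sqnormD sqnormN -scaleN1r hdotZr rmorphN1 mulN1r.
by case: (form u v) => a b /=; ring.
Qed.

(* With [e = sqnorm y] and [D = 0] this is Cauchy-Schwarz. *)
Lemma near_minimal_orthogonal (y w : U) (D e : R) :
  (forall c, D <= sqnorm (y - c *: w)) -> sqnorm y <= D + e ->
  sqmod (form y w) <= e * sqnorm w.
Proof.
move=> yD ye.
have [w0|w0] := eqVneq (sqnorm w) 0.
  by rewrite (sqnorm_eq0 w0) hdot0r /sqnorm hdot0l /sqmod /= expr0n addr0 mulr0.
have wp : 0 < sqnorm w by rewrite lt0r w0 sqnorm_ge0.
have := yD (((sqnorm w)^-1)%:C * form y w).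
rewrite sqnormD sqnormN sqnormZ -scaleN1r hdotZr rmorphN1 mulN1r hdotZr.
set z := form y w; set r := (sqnorm w)^-1.
have -> : sqmod (r%:C * z) = r ^+ 2 * sqmod z.
  by case: z => a b; rewrite /sqmod /=; ring.
have -> : reC (- (Num.conj (r%:C * z) * z)) = - (r * sqmod z).
  by case: z => a b; rewrite /sqmod /=; ring.
have rw : r * sqnorm w = 1 by rewrite mulVf.
have -> : r ^+ 2 * sqmod z * sqnorm w = r * sqmod z by rewrite expr2 -mulrA [sqmod z * _]mulrC mulrA -[r * r * _]mulrA rw mulr1.
move=> h; have : r * sqmod z <= e by lra.
move=> h2; rewrite -[sqmod z]mul1r -rw mulrAC.
by rewrite ler_wpM2r// ltW.
Qed.

Lemma cauchy_schwarz (y w : U) : sqmod (form y w) <= sqnorm y * sqnorm w.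
Proof.
by apply: (@near_minimal_orthogonal y w 0) => [c|]; rewrite ?sqnorm_ge0// add0r.
Qed.

Lemma hilbert_norm_lt (u : U) (r : R) : 0 < r ->
  (hilbert_norm form u < r%:C) = (sqnorm u < r ^+ 2).
Proof.
move=> r0; rewrite /hilbert_norm hdotE.
have -> : r%:C = sqrtC ((r ^+ 2)%:C).
  by rewrite rmorphXn /= sqrCK// lecR ltW.
by rewrite ltr_sqrtC ?nnegrE ?lecR ?sqnorm_ge0 ?sqr_ge0// ltcR.
Qed.

Lemma hilbert_normK (u : U) : hilbert_norm form u ^+ 2 = (sqnorm u)%:C.
Proof. by rewrite /hilbert_norm sqrtCK hdotE. Qed.

Lemma bounded_op_sqnorm (A : U -> U) : bounded_op form A ->
  exists2 K, 0 <= K & forall u, sqnorm (A u) <= K * sqnorm u.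
Proof.
move=> [K K0 AK]; exists (sqmod K); first exact: sqmod_ge0.
move=> u; rewrite -lecR rmorphM /= -mul_conjE.
rewrite -!hilbert_normK (CrealP (ger0_real K0)) -expr2 -exprMn.
have h v : 0 <= hilbert_norm form v by rewrite /hilbert_norm sqrtC_ge0 dnorm_ge0.
by rewrite ler_pXn2r// ?nnegrE ?mulr_ge0.
Qed.

(** Completeness tested on geometrically Cauchy sequences only. The constant [C] is left free so
    that bounds for components can be added, as for real and imaginary parts or for a direct sum. *)
Definition complete_form := forall u : nat -> U,
  (forall n m, (n <= m)%N -> sqnorm (u m - u n) <= 4^-1 ^+ n) ->
  exists C v, forall n, sqnorm (v - u n) <= C * 4^-1 ^+ n.

Lemma geometric_small (C e : R) : 0 < e -> exists n, C * 4^-1 ^+ n < e.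
Proof.
move=> e0.
have : (C * 4^-1 ^+ n) @[n --> \oo] --> C * 0.
  apply: cvgM; [exact: cvg_cst|apply: cvg_expr].
  by rewrite ger0_norm; lra.
rewrite mulr0 => /cvgrPdist_lt/(_ e e0)[n _ /(_ n (leqnn n))].
by rewrite sub0r normrN => /(le_lt_trans (ler_norm _)) h; exists n.
Qed.

Lemma closed_subspace_limit (M : set U) (C : R) (m : nat -> U) (v : U) :
  closed_subspace form M -> (forall n, M (m n)) ->
  (forall n, sqnorm (v - m n) <= C * 4^-1 ^+ n) -> M v.
Proof.
move=> [_ _ cM] Mm vm; apply: cM => e; case: e => r i.
rewrite ltcE /= => /andP[/eqP-> r0].
have [n hn] := @geometric_small C (r ^+ 2) (exprn_gt0 2 r0).
exists (m n) => //; rewrite hilbert_norm_lt//.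
exact: le_lt_trans (vm n) hn.
Qed.

Lemma closed_subspaceD (M : set U) u v : closed_subspace form M -> M u -> M v -> M (u + v).
Proof. by move=> [_ lM _] Mu Mv; rewrite -[u]scale1r; exact: lM. Qed.

Lemma closed_subspaceZ (M : set U) c u : closed_subspace form M -> M u -> M (c *: u).
Proof. by move=> [M0 lM _] Mu; rewrite -[_ *: _]addr0; exact: lM. Qed.

(** The parallelogram law makes a minimizing sequence Cauchy; the residuals of its terms are nearly
    orthogonal to the subspace, and orthogonality passes to the limit. *)
Lemma projection_exists (M : set U) (u : U) : complete_form ->
  closed_subspace form M -> exists2 v, M v & ortho_compl form M (u - v).
Proof.
move=> cU cM; have [M0 _ _] := cM.
pose S := [set sqnorm (u - m) | m in M].
have Sinf : has_inf S.
  by split; [exists (sqnorm (u - 0)), 0|exists 0 => _ [m _ <-]; exact: sqnorm_ge0].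
pose D := inf S.
have DS m : M m -> D <= sqnorm (u - m).
  by move=> Mm; apply: ge_inf; [exact: Sinf.2|exists m].
have e0 n : 0 < 4^-1 ^+ n.+1 :> R by rewrite exprn_gt0.
(* The excess [4^-1 ^+ n.+1] is what the parallelogram law multiplies by 4, giving the rate
   [4^-1 ^+ n] required by [complete_form]. *)
have /choice[m mP] : forall n, exists m, M m /\ sqnorm (u - m) <= D + 4^-1 ^+ n.+1.
  move=> n; have [_ [m Mm <-] h] := inf_adherent (e0 n) Sinf.
  by exists m; split => //; exact: ltW.
have Mm n : M (m n) by have [] := mP n.
have mD n : sqnorm (u - m n) <= D + 4^-1 ^+ n.+1 by have [] := mP n.
have mC n j : (n <= j)%N -> sqnorm (m j - m n) <= 4^-1 ^+ n.
  move=> nj; have := sqnorm_parallelogram (u - m n) (u - m j).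
  have -> : u - m n - (u - m j) = m j - m n by rewrite opprB addrC addrA subrK.
  have -> : u - m n + (u - m j) = 2%:C *: (u - 2^-1%:C *: (m n + m j)).
    rewrite scalerBr scalerA -rmorphM /= divff// scale1r.
    by rewrite rmorphD rmorph1 scalerDl scale1r opprD addrACA.
  rewrite sqnormZ /sqmod /= expr0n addr0.
  have := DS _ (closed_subspaceZ 2^-1%:C cM (closed_subspaceD cM (Mm n) (Mm j))).
  have := mD n; have := mD j; rewrite !exprS.
  have : 4^-1 ^+ j <= 4^-1 ^+ n :> R by apply: ler_wiXn2l => //; lra.
  move: (4^-1 ^+ j) (4^-1 ^+ n) => x y; lra.
have [C [v vP]] := cU m mC.
have Mv : M v by exact: closed_subspace_limit cM Mm vP.
exists v => // w Mw; apply: sqmod_eq0; apply/eqP; rewrite eq_le sqmod_ge0 andbT leNgt.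
apply/negP => h.
(* The constant anticipates the two halves of [sqmodD]: twice [4^-1 ^+ n.+1] from near minimality
   and twice [C * 4^-1 ^+ n] from convergence. *)
have [n] := @geometric_small ((2^-1 + 2 * C) * sqnorm w) _ h.
apply/negP; rewrite -leNgt.
have -> : u - v = (u - m n) + (m n - v) by rewrite addrA subrK.
rewrite hdotDl; apply: le_trans (sqmodD _ _) _.
have h1 : sqmod (form (u - m n) w) <= 4^-1 ^+ n.+1 * sqnorm w.
  apply: (@near_minimal_orthogonal _ _ D) => // c.
  by rewrite -addrA -opprD; apply: DS; apply: closed_subspaceD => //; exact: closed_subspaceZ.
have h2 : sqmod (form (m n - v) w) <= C * 4^-1 ^+ n * sqnorm w.
  apply: le_trans (cauchy_schwarz _ _) _; rewrite ler_wpM2r ?sqnorm_ge0// sqnorm_distC.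
  exact: vP.
rewrite exprS in h1; nra.
Qed.

End hilbert.

(** * L^2 of the circle: the orthonormal total family z^n, and completeness *)

Section L2_circle.
Context {R : realType}.
Local Existing Instance ae_circle.
Local Notation mu := (circle_measure R).
Local Notation leb := (@lebesgue_measure R).
Local Notation reC := complex.Re.
Local Notation imC := complex.Im.
Implicit Types f g : L2fun R.

Definition zfun n : L2fun R := MkL2fun (circle_pow_sqint R n).

Lemma Lfun2_integrable (h : R -> R) : h \in Lfun mu 2%:E ->
  mu.-integrable setT (EFin \o h).
Proof.
move=> hL; apply/Lfun1_integrable.
by apply: Lfun_subset12 hL; rewrite fin_num_measure.
Qed.

Lemma cos_sin_int2pi (k : int) :
  cos (k%:~R * (pi *+ 2)) = 1 :> R /\ sin (k%:~R * (pi *+ 2)) = 0 :> R.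
Proof.
have N (n : nat) : cos (n%:R * (pi *+ 2)) = 1 :> R /\ sin (n%:R * (pi *+ 2)) = 0 :> R.
  elim: n => [|n [c s]]; first by rewrite mul0r cos0 sin0.
  by rewrite -natr1 mulrDl mul1r cosD2pi sinD2pi.
case: k => n; first exact: N.
by rewrite NegzE mulrNz mulNr cosN sinN; have [-> ->] := N n.+1; rewrite oppr0.
Qed.

Lemma integral_circle_derive (F f : R -> R) :
  (forall t : R, is_derive t 1 F (f t)) -> continuous f -> (forall t, `|f t| <= 1) ->
  F (pi *+ 2) = F 0 -> \int[mu]_t f t = 0.
Proof.
move=> dF cf f1 F0.
have i1 : mu.-integrable setT (EFin \o f).
  exact: Lfun2_integrable (Lfun2_bounded cf f1).
have cF : continuous F.
  by move=> t; apply/differentiable_continuous/derivable1_diffP; case: (dF t).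
have H := @continuous_FTC2 R f F 0 (pi *+ 2) (twopi_gt0 R).
rewrite /Rintegral [X in fine X]integral_circle// H.
- by rewrite F0 -EFinB subrr mule0.
- exact: continuous_subspaceT.
- split.
  + by move=> t _; case: (dF t).
  + exact: cvg_at_right_filter (cF 0).
  + exact: cvg_at_left_filter (cF _).
- by move=> t _; rewrite derive1E; apply: derive_val.
Qed.

Lemma circle_itv_integral_sin_cos (k : int) : k != 0 ->
  \int[mu]_t cos (k%:~R * t) = 0 /\ \int[mu]_t sin (k%:~R * t) = 0.
Proof.
move=> k0; have kR : k%:~R != 0 :> R by rewrite intr_eq0.
have [c2 s2] := cos_sin_int2pi k.
split.
  apply: (@integral_circle_derive (fun t => k%:~R^-1 * sin (k%:~R * t))).
  - move=> t; apply: is_derive_eq; rewrite /GRing.scale /= mulr1; by field.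
  - by move=> t; apply: continuous_comp; [exact: mulrl_continuous|exact: continuous_cos].
  - by move=> t; exact: cos_max.
  - by rewrite s2 !mulr0 sin0 mulr0.
apply: (@integral_circle_derive (fun t => - k%:~R^-1 * cos (k%:~R * t))).
- move=> t; apply: is_derive_eq; rewrite /GRing.scale /= mulr1; by field.
- by move=> t; apply: continuous_comp; [exact: mulrl_continuous|exact: continuous_sin].
- by move=> t; exact: sin_max.
- by rewrite c2 mulr0 cos0.
Qed.

(** One complex coefficient mixes the real and imaginary parts of [f]; the coefficients at [n] and
    [- n] give four real equations that separate them, so both parts are [trig_null]. *)
Lemma circle_pow_total f : (forall n, dotfun f (zfun n) = 0) ->
  {ae mu, forall t, f t = 0}.
Proof.
move=> f0.
pose fr t := reC (f t); pose fi t := imC (f t).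
have ir : mu.-integrable setT (EFin \o fr) by exact: Lfun2_integrable (L2fun_re f).
have ii : mu.-integrable setT (EFin \o fi) by exact: Lfun2_integrable (L2fun_im f).
have ic (h : R -> R) (a : R) : mu.-integrable setT (EFin \o h) ->
    mu.-integrable setT (EFin \o (fun t => h t * cos (a * t))).
  by move=> ih; have := integrable_mul_cos a 0 ih; under eq_fun do rewrite addr0.
have isn (h : R -> R) (a : R) : mu.-integrable setT (EFin \o h) ->
    mu.-integrable setT (EFin \o (fun t => h t * sin (a * t))).
  move=> ih; have := integrable_mul_cos a (- (pi / 2)) ih.
  by under eq_fun do rewrite cosBpihalf.
have E (n : int) :
    \int[mu]_t (fr t * cos (n%:~R * t)) + \int[mu]_t (fi t * sin (n%:~R * t)) = 0 /\
    \int[mu]_t (fi t * cos (n%:~R * t)) - \int[mu]_t (fr t * sin (n%:~R * t)) = 0.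
  have := f0 n; rewrite /dotfun /Cintegral => /eqP; rewrite eq_complex /= => /andP[/eqP h1 /eqP h2].
  split.
    rewrite -RintegralD//; [|exact: ic|exact: isn].
    rewrite -[RHS]h1; apply: eq_Rintegral => t _.
    by rewrite reCM reC_conj imC_conj /= mulrN opprK.
  rewrite -RintegralB//; [|exact: ic|exact: isn].
  rewrite -[RHS]h2; apply: eq_Rintegral => t _.
  by rewrite imCM reC_conj imC_conj /= mulrN addrC.
have N (n : int) (h : R -> R) : \int[mu]_t (h t * cos ((- n)%:~R * t)) = \int[mu]_t (h t * cos (n%:~R * t)).
  by apply: eq_Rintegral => t _; rewrite mulrNz mulNr cosN.
have M (n : int) (h : R -> R) : mu.-integrable setT (EFin \o h) ->
    \int[mu]_t (h t * sin ((- n)%:~R * t)) = - \int[mu]_t (h t * sin (n%:~R * t)).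
  move=> ih; rewrite -[RHS]mulN1r -RintegralZl//; last exact: isn.
  by apply: eq_Rintegral => t _; rewrite mulrNz mulNr sinN mulrN mulN1r.
have Z (h : R -> R) : mu.-integrable setT (EFin \o h) ->
    (forall n : int, \int[mu]_t (h t * cos (n%:~R * t)) = 0 /\ \int[mu]_t (h t * sin (n%:~R * t)) = 0) ->
    trig_null h.
  move=> ih h0; split => // n b; have [c0 s0] := h0 n.
  transitivity (\int[mu]_t (cos b * (h t * cos (n%:~R * t)) - sin b * (h t * sin (n%:~R * t)))).
    by apply: eq_Rintegral => t _; rewrite cosD; ring.
  rewrite RintegralB//; [|by apply: integrable_scale; exact: ic|by apply: integrable_scale; exact: isn].
  rewrite !RintegralZl//; [|exact: isn|exact: ic].
  by rewrite c0 s0 !mulr0 subr0.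
have Nr : trig_null fr.
  apply: Z => // n; have [e1 e2] := E n; have [] := E (- n); rewrite !N !M// => e3 e4.
  by split; lra.
have Ni : trig_null fi.
  apply: Z => // n; have [e1 e2] := E n; have [] := E (- n); rewrite !N !M// => e3 e4.
  by split; lra.
apply: filterS2 (trig_null_ae0 Nr) (trig_null_ae0 Ni) => t; rewrite /fr /fi.
by case: (f t) => a b /= -> ->.
Qed.

Lemma zpow_total (u : L2T R) : (forall n, dotL2T u (zpow R n) = 0) -> u = 0.
Proof.
elim/quotW: u => f f0.
have <- : \pi_(L2T R)%qT 0 = 0 by rewrite raddf0.
apply/eqP/L2T_eqP; apply: circle_pow_total => n.
by rewrite -dotL2T_pi; exact: f0.
Qed.

Lemma zpow_orthonormal m n : dotL2T (zpow R m) (zpow R n) = (m == n)%:R.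
Proof.
rewrite dotL2T_pi /dotfun /Cintegral.
have e t : circle_pow m t * Num.conj (circle_pow n t) = circle_pow (m - n) t :> R[i].
  rewrite /circle_pow intrB mulrBl cosB sinB.
  by apply/eqP; rewrite eq_complex /=; apply/andP; split; apply/eqP; ring.
under eq_Rintegral do rewrite e /=.
under [X in _ +i* X]eq_Rintegral do rewrite e /=.
have [->|mn] := eqVneq m n.
  rewrite subrr; under eq_Rintegral do rewrite mul0r cos0.
  under [X in _ +i* X]eq_Rintegral do rewrite mul0r sin0.
  by rewrite !Rintegral_cst// mul0r [X in 1 * fine X](probability_setT mu) mulr1.
have [|-> ->//] := @circle_itv_integral_sin_cos (m - n).
by rewrite subr_eq0.
Qed.

Lemma sqnorm_pi f : (sqnorm (@dotL2T R) (\pi_(L2T R)%qT f))%:E =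
  (\int[mu]_t (reC (f t) ^+ 2)%:E + \int[mu]_t (imC (f t) ^+ 2)%:E)%E.
Proof.
rewrite /sqnorm [X in reC X]dotL2T_pi /dotfun /Cintegral /=.
have h1 := Lfun2_integrable_sqr (L2fun_re f).
have h2 := Lfun2_integrable_sqr (L2fun_im f).
rewrite -integralD//= fineK.
  by apply: eq_integral => t _; rewrite reCM reC_conj imC_conj mulrN opprK -!expr2 EFinD.
by apply: integrable_fin_num => //; have [] := CintegrableM f f.
Qed.

(** Riesz-Fischer is applied to real and imaginary parts of representatives; adding the two bounds
    produces the constant 2. *)
Lemma L2T_complete : complete_form (@dotL2T R).
Proof.
move=> u uC; pose f n := repr (u n).
have uf n : u n = \pi_(L2T R)%qT (f n) by rewrite reprK.
have D n m : (n <= m)%N ->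
    (\int[mu]_t (reC (f m t - f n t) ^+ 2)%:E + \int[mu]_t (imC (f m t - f n t) ^+ 2)%:E <= (4^-1 ^+ n)%:E)%E.
  move=> /uC; rewrite !uf -raddfB -lee_fin sqnorm_pi; exact.
have reB (x y : R[i]) : reC (x - y) = reC x - reC y by case: x y => [a b] [c d].
have imB (x y : R[i]) : imC (x - y) = imC x - imC y by case: x y => [a b] [c d].
have p0 (h : R -> R) : (0 <= \int[mu]_t (h t ^+ 2)%:E)%E.
  by apply: integral_ge0 => t _; rewrite lee_fin sqr_ge0.
have [n m nm|gr Lr Er] := @Lfun2_complete _ _ _ mu (fun n t => reC (f n t)) (fun n => L2fun_re (f n)).
  apply: le_trans (D _ _ nm); under eq_integral do rewrite -reB.
  by rewrite leeDl.
have [n m nm|gi Li Ei] := @Lfun2_complete _ _ _ mu (fun n t => imC (f n t)) (fun n => L2fun_im (f n)).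
  apply: le_trans (D _ _ nm); under eq_integral do rewrite -imB.
  by rewrite leeDr.
have gP : (fun t => gr t +i* gi t) \in @sqint R by apply/andP.
exists 2, (\pi_(L2T R)%qT (MkL2fun gP)) => n; rewrite uf -raddfB -lee_fin sqnorm_pi.
rewrite mulrDl mul1r EFinD; apply: leeD.
  by apply: le_trans (Er n); rewrite le_eqVlt; apply/orP; left; apply/eqP; apply: eq_integral => t _; rewrite /= reB.
by apply: le_trans (Ei n); rewrite le_eqVlt; apply/orP; left; apply/eqP; apply: eq_integral => t _; rewrite /= imB.
Qed.

End L2_circle.

(** * Total families and bounded operators *)

Section total_families.
Context {R : realType} {U : lmodType R[i]} {I : Type} (form : {dot U for Num.conj}).
Implicit Types e : I -> U.

Definition total_family e := forall u, (forall i, form u (e i) = 0) -> u = 0.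

Lemma total_closed_subspace e (M : set U) : complete_form form -> total_family e ->
  closed_subspace form M -> (forall i, M (e i)) -> M = setT.
Proof.
move=> cU te cM Me; apply/seteqP; split => // u _.
have [v Mv uv] := projection_exists u cU cM.
suff -> : u = v by [].
by apply/subr0_eq/te => i; exact: uv.
Qed.

(** The conclusion identifies [w] as the adjoint of [A] applied to [v], with no adjoint constructed.
    The zero set of the bounded functional [phi] is a closed subspace containing the total
    family. *)
Lemma total_bounded_eq e (A : {linear U -> U}) (v w : U) :
  complete_form form -> total_family e -> bounded_op form A ->
  (forall i, form (A (e i)) v = form (e i) w) -> forall u, form (A u) v = form u w.
Proof.
move=> cU te /bounded_op_sqnorm[K K0 AK] h.
pose phi u := form (A u) v - form u w.
have phiL c x y : phi (c *: x + y) = c * phi x + phi y.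
  by rewrite /phi [A _]linearP !hdotDl !hdotZl; ring.
pose L := 2 * (K * sqnorm form v) + 2 * sqnorm form w.
have L0 : 0 <= L by rewrite addr_ge0// !mulr_ge0 ?sqnorm_ge0.
have phi_bound x : sqmod (phi x) <= L * sqnorm form x.
  rewrite /phi; apply: (le_trans (sqmodD _ _)).
  have -> : sqmod (- form x w) = sqmod (form x w).
    by case: (form x w) => a b; rewrite /sqmod /= !sqrrN.
  have h1 : sqmod (form (A x) v) <= K * sqnorm form x * sqnorm form v.
    apply: (le_trans (cauchy_schwarz form _ _)).
    by rewrite ler_wpM2r ?sqnorm_ge0.
  have h2 := cauchy_schwarz form x w.
  by rewrite /L; nra.
suff : [set u | phi u = 0] = setT.
  by move=> E u; apply/subr0_eq; have : [set u | phi u = 0] u by rewrite E.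
apply: (total_closed_subspace cU te) => [|i]; last by rewrite /= /phi h subrr.
split.
- by rewrite /= /phi linear0 !hdot0l subrr.
- by move=> c x y /= px py; rewrite phiL px py mulr0 addr0.
- move=> u hu; apply: sqmod_eq0; apply/eqP; rewrite eq_le sqmod_ge0 andbT leNgt.
  apply/negP => p0.
  (* Chosen so that a zero of [phi] within distance [r] of [u] contradicts the bound on [phi];
     [L + 1] is used because [L] may be 0. *)
  pose r := Num.sqrt (sqmod (phi u) / (L + 1)).
  have q0 : 0 < sqmod (phi u) / (L + 1) by rewrite divr_gt0//; lra.
  have r0 : 0 < r by rewrite sqrtr_gt0.
  have [|x px ux] := hu r%:C; first by rewrite ltcR.
  move: ux; rewrite hilbert_norm_lt// sqr_sqrtr ?ltW// ltr_pdivlMr; last by lra.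
  apply/negP; rewrite -leNgt.
  have -> : phi u = phi (u - x).
    by rewrite -scaleN1r addrC phiL px mulr0 add0r.
  apply: (le_trans (phi_bound _)); rewrite mulrC ler_wpM2l ?sqnorm_ge0//; lra.
Qed.

End total_families.

(** * The orthogonal projection onto a reducing subspace *)

Section reducing_projection.
Context {R : realType} {U : lmodType R[i]} (form : {dot U for Num.conj}).

Lemma ortho_complC (M : set U) u v : ortho_compl form M u -> M v -> form v u = 0.
Proof. by move=> Mu Mv; rewrite hdotC Mu// rmorph0. Qed.

Lemma projection_unique (M : set U) u p q : closed_subspace form M ->
  M p -> ortho_compl form M (u - p) -> M q -> ortho_compl form M (u - q) -> p = q.
Proof.
move=> cM Mp up Mq uq; apply/subr0_eq/(@sqnorm_eq0 _ _ form).
have Mpq : M (p - q).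
  by apply: (closed_subspaceD cM Mp); rewrite -scaleN1r; exact: closed_subspaceZ cM Mq.
have -> : sqnorm form (p - q) = complex.Re (form ((u - q) - (u - p)) (p - q)).
  by rewrite /sqnorm opprB [u - q + _]addrC addrA subrK.
by rewrite hdotBl uq// up// subrr.
Qed.

(** [A] maps the decomposition of [u] along [M] and its complement to that of [A u], so uniqueness
    gives commutation, and linearity likewise. For self-adjointness both sides equal
    [form (P u) (P v)]. *)
Lemma reducing_projection (A : U -> U) (M : set U) : complete_form form ->
  (forall u v, A (u + v) = A u + A v) ->
  reducing form A M ->
  exists P : U -> U,
    [/\ forall u, M (P u) /\ ortho_compl form M (u - P u),
        forall c u v, P (c *: u + v) = c *: P u + P v,
        forall u, P (A u) = A (P u) &
        forall u v, form (P u) v = form u (P v)].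
Proof.
move=> cU AD [cM AM AO].
have /choice[P PP] : forall u, exists p, M p /\ ortho_compl form M (u - p).
  by move=> u; have [p ? ?] := projection_exists u cU cM; exists p.
have MP u : M (P u) by have [] := PP u.
have OP u : ortho_compl form M (u - P u) by have [] := PP u.
have OD c u v : ortho_compl form M u -> ortho_compl form M v -> ortho_compl form M (c *: u + v).
  by move=> ou ov w Mw; rewrite hdotDl hdotZl ou// ov// mulr0 addr0.
exists P; split => //.
- move=> c u v; apply: (projection_unique cM (MP _) (OP _)).
    by have [_ lM _] := cM; exact: lM.
  by rewrite opprD addrACA -scalerBr; exact: OD.
- move=> u; apply: (projection_unique cM (MP _) (OP _)); first by apply: AM; exists (P u).
  have -> : A u - A (P u) = A (u - P u).
    by apply/eqP; rewrite subr_eq -AD subrK.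
  by apply: AO; exists (u - P u).
- move=> u v.
  have -> : form (P u) v = form (P u) (P v).
    by apply/subr0_eq; rewrite -hdotBr; exact: ortho_complC (OP v) (MP u).
  by apply/esym/subr0_eq; rewrite -hdotBl; exact: (OP u _ (MP v)).
Qed.

End reducing_projection.

(** * Algebra of the 2x2 blocks of an intertwiner *)

Section entries.
Context {F : fieldType}.

(* [w], [v] are inverse to each other (conjugate unimodular weights), [b = alpha (w - 1)], [c = alpha (v - 1)];
   primed variables belong to the other index. *)
Lemma intertwining_entries (w v b c w' v' b' c' x11 x12 x21 x22 y11 y12 y21 y22 : F) :
  w * v = 1 -> w' * v' = 1 -> w * c = - b -> w' * c' = - b' ->
  w * y11 = w' * x11 + b' * x21 -> w * y21 = x21 ->
  b * y11 + y12 = w' * x12 + b' * x22 -> b * y21 + y22 = x22 ->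
  v' * y11 = v * x11 + c * x12 -> v' * y12 = x12 ->
  c' * y11 + y21 = v * x21 + c * x22 -> c' * y12 + y22 = x22 ->
  [/\ c' * x21 = b * x12, c * x11 - b * c * x12 = c' * x22,
      b' * x11 - b' * c' * x21 = b * x22 & c * x21 = b' * x12].
Proof.
move=> wv wv' wc wc' e1 e2 e3 e4 f1 f2 f3 f4.
have Y21 : y21 = v * x21 by rewrite -e2 mulrA [v * w]mulrC wv mul1r.
have Y12 : y12 = w' * x12 by rewrite -f2 mulrA wv' mul1r.
have vb : v * b = - c by rewrite -[b]opprK -wc mulrN mulrA [v * w]mulrC wv mul1r.
have vb' : v' * b' = - c' by rewrite -[b']opprK -wc' mulrN mulrA [v' * w']mulrC wv' mul1r.
have Y11 : y11 = v * w' * x11 + v * b' * x21.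
  by transitivity (v * (w * y11)); [rewrite mulrA [v * w]mulrC wv mul1r|rewrite e1; ring].
have A : c' * x21 = b * x12.
  have E : (w * v) * (w' * v') * x11 + (w * v) * (v' * b') * x21 = (w * v) * x11 + (w * c) * x12.
    by transitivity (w * (v' * y11)); [rewrite Y11; ring|rewrite f1; ring].
  move: E; rewrite wv wv' vb' wc !mul1r !mulNr => /addrI /oppr_inj ->.
  by [].
have B : b * y11 = b' * x22.
  by apply: (@addrI _ y12); rewrite [LHS]addrC e3 Y12.
have C : c' * y11 = c * x22.
  by apply: (@addrI _ y21); rewrite [LHS]addrC f3 Y21.
split => //.
- have E : (v * b) * (w' * v') * x11 + (v * b) * (v' * b') * x21 = (v' * b') * x22.
    by transitivity (v' * (b * y11)); [rewrite Y11; ring|rewrite B; ring].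
  move: E; rewrite wv' vb vb' mulr1 => E.
  apply: oppr_inj; rewrite -[RHS]mulNr -E.
  by transitivity (- c * x11 + c * (b * x12)); [ring|rewrite -A; ring].
- have E : (w * v) * (w' * c') * x11 + (w * v) * b' * c' * x21 = (w * c) * x22.
    by transitivity (w * (c' * y11)); [rewrite Y11; ring|rewrite C; ring].
  move: E; rewrite wv wc' wc !mul1r => E.
  by apply: oppr_inj; rewrite -[RHS]mulNr -E; ring.
- have E : b * y21 = c' * y12.
    by apply: (@addIr _ y22); rewrite e4 f4.
  have : (v * b) * x21 = (w' * c') * x12.
    by transitivity (b * y21); [rewrite Y21; ring|rewrite E Y12; ring].
  by rewrite vb wc' !mulNr => /oppr_inj.
Qed.

(** The matrices T_n^* T_n and T_m^* T_m have determinant 1 and traces [2 + b c] and [2 + b' c'];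
    distinct traces leave no common eigenvalue, so an intertwiner vanishes. Here [b c - b' c'] is
    seen to annihilate [x12], then [x11]. *)
Lemma intertwining_eq0 (b c b' c' x11 x12 x21 x22 : F) :
  b != 0 -> c' != 0 -> b * c != b' * c' ->
  c' * x21 = b * x12 -> c * x11 - b * c * x12 = c' * x22 ->
  b' * x11 - b' * c' * x21 = b * x22 -> c * x21 = b' * x12 ->
  [/\ x11 = 0, x12 = 0, x21 = 0 & x22 = 0].
Proof.
move=> b0 c0 t h1 h2 h3 h4.
have t0 : b * c - b' * c' != 0 by rewrite subr_eq0.
have Z x : (b * c - b' * c') * x = 0 -> x = 0.
  by move=> /eqP; rewrite mulf_eq0 (negbTE t0) => /eqP.
have X12 : x12 = 0.
  apply: Z; rewrite mulrBl; apply/eqP; rewrite subr_eq0; apply/eqP.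
  transitivity (c * (b * x12)); first by ring.
  by rewrite -h1; transitivity (c' * (c * x21)); [ring|rewrite h4; ring].
have X21 : x21 = 0.
  by apply/eqP; move/eqP: h1; rewrite X12 mulr0 mulf_eq0 (negbTE c0).
move: h2 h3; rewrite X12 X21 !mulr0 !subr0 => h2 h3.
have X11 : x11 = 0.
  apply: Z; rewrite mulrBl; apply/eqP; rewrite subr_eq0; apply/eqP.
  transitivity (b * (c * x11)); first by ring.
  by rewrite h2; transitivity (c' * (b * x22)); [ring|rewrite -h3; ring].
split => //; apply/eqP; move/eqP: h3; rewrite X11 mulr0 eq_sym mulf_eq0.
by rewrite (negbTE b0).
Qed.

(* [x] has to commute with [T_n^* T_n], hence [y] with [T_n T_n^*]; the last two premises say that [y]
   commutes with [T_(n+1)^* T_(n+1)], whose parameters are [b1] and [c1]. *)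
Lemma commuting_scalar (w v b c b1 c1 x11 x12 x21 x22 y11 y12 y21 y22 : F) :
  w * v = 1 -> w * c = - b -> b != 0 -> c != 0 -> c1 != 0 -> c != b1 ->
  w * y21 = x21 -> b * y21 + y22 = x22 -> v * y11 = v * x11 + c * x12 -> v * y12 = x12 ->
  c * x21 = b * x12 -> c * x11 - b * c * x12 = c * x22 ->
  c1 * y11 - b1 * c1 * y12 = c1 * y22 ->
  [/\ y12 = 0, y21 = 0 & y11 = y22].
Proof.
move=> wv wc b0 c0 c10 cb e2 e4 f1 f2 h1 h2 g.
have vb : v * b = - c by rewrite -[b]opprK -wc mulrN mulrA [v * w]mulrC wv mul1r.
have A : b * y21 = c * y12.
  have : (w * c) * y21 = (v * b) * y12.
    by transitivity (c * x21); [rewrite -e2; ring|rewrite h1 -f2; ring].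
  by rewrite wc vb !mulNr => /oppr_inj.
have B : x11 = y11 - c * y12.
  have : (w * v) * y11 = (w * v) * x11 + (w * c) * x12.
    by transitivity (w * (v * y11)); [ring|rewrite f1; ring].
  rewrite wv wc !mul1r -f2 => ->.
  by transitivity (x11 + - (v * b) * y12 - c * y12); [rewrite vb; ring|ring].
have C : y11 = c * y12 + y22.
  apply: (mulfI c0); transitivity (c * x22); last by rewrite -e4 A.
  rewrite -h2 B -f2.
  by transitivity (c * (y11 - c * y12) - c * (v * b) * y12); [rewrite vb; ring|ring].
have D : y11 = b1 * y12 + y22.
  by apply: (mulfI c10); rewrite mulrDr -g; ring.
have y12_0 : y12 = 0.
  have /eqP : (c - b1) * y12 = 0.
    by apply: (@addIr _ y22); rewrite mulrBl add0r -addrA [- _ + _]addrC addrA -C D; ring.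
  by rewrite mulf_eq0 subr_eq0 (negbTE cb) => /eqP.
split => //; last by rewrite D y12_0 mulr0 add0r.
by move/eqP: A; rewrite y12_0 mulr0 mulf_eq0 (negbTE b0) => /eqP.
Qed.

End entries.

(** * Irreducibility of a block weighted shift over an abstract orthonormal total family *)

Section block_shift.
Context {R : realType} {U : lmodType R[i]} (form : {dot U for Num.conj}) (e : int -> U).
Local Notation H := (U * U)%type.
Local Notation hform := (dsum_dot form form : {dot H for Num.conj}).

Lemma dsum_dotE (u v : H) : hform u v = form u.1 v.1 + form u.2 v.2.
Proof. by []. Qed.

Lemma complete_dsum : complete_form form -> complete_form hform.
Proof.
move=> cU u uC.
have sq (v : H) : sqnorm hform v = sqnorm form v.1 + sqnorm form v.2.
  by rewrite /sqnorm -reCD.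
have [n m nm|C1 [v1 v1P]] := cU (fun n => (u n).1).
  by apply: le_trans (uC _ _ nm); rewrite sq lerDl sqnorm_ge0.
have [n m nm|C2 [v2 v2P]] := cU (fun n => (u n).2).
  by apply: le_trans (uC _ _ nm); rewrite sq lerDr sqnorm_ge0.
exists (C1 + C2), (v1, v2) => n; rewrite sq mulrDl.
by apply: lerD; [exact: v1P|exact: v2P].
Qed.

Definition dsum_family (i : bool * int) : H := if i.1 then (e i.2, 0) else (0, e i.2).

Lemma total_dsum_family : total_family form e -> total_family hform dsum_family.
Proof.
move=> te [u1 u2] h; congr pair; apply: te => n.
  by have := h (true, n); rewrite dsum_dotE /dsum_family /= hdot0r addr0.
by have := h (false, n); rewrite dsum_dotE /dsum_family /= hdot0r add0r.
Qed.

(** The weight hypotheses are matrix conditions in scalar form: [alpha ^+ 2] times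
    [(w n - 1) * (conj (w n) - 1)] is the trace of T_n^* T_n minus 2, and [conj (w 0) != w 1] says
    that T_0 T_0^* and T_1^* T_1 do not commute. *)
Lemma block_shift_irreducible (alpha : R) (w : int -> R[i]) (B Bs : {linear U -> U}) :
  complete_form form -> total_family form e ->
  (forall m n, form (e m) (e n) = (m == n)%:R) ->
  bounded_op form B -> bounded_op form Bs ->
  (forall n, B (e n) = e (n + 1)) -> (forall n, Bs (e n) = w n *: e (n + 1)) ->
  alpha != 0 ->
  (forall n, w n * Num.conj (w n) = 1) -> (forall n, w n != 1) ->
  (forall m n, m != n ->
    (w n - 1) * (Num.conj (w n) - 1) != (w m - 1) * (Num.conj (w m) - 1) \/
    (w (n - 1) - 1) * (Num.conj (w (n - 1)) - 1) !=
      (w (m - 1) - 1) * (Num.conj (w (m - 1)) - 1)) ->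
  Num.conj (w 0) != w 1 ->
  irreducible hform
    (block_op Bs (fun u => alpha%:C *: (Bs u - B u)) (fun=> 0) B).
Proof.
move=> cU te eo bB bBs Be Bse a0 wv w1 wsep w01 M redM.
set T := block_op _ _ _ _ in redM *.
have cH := complete_dsum cU.
have tH := total_dsum_family te.
have aC0 : alpha%:C != 0 :> R[i] by rewrite eq_complex /= eqxx andbT.
have aC : Num.conj alpha%:C = alpha%:C :> R[i] by apply/eqP; rewrite eq_complex /= oppr0 !eqxx.
pose v n := Num.conj (w n); pose b n := alpha%:C * (w n - 1).
pose c n := alpha%:C * (v n - 1).
have bc n : Num.conj (b n) = c n by rewrite /b rmorphM rmorphB rmorph1 /= aC.
have wvn n : w n * v n = 1 by exact: wv.
have wc n : w n * c n = - b n.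
  by rewrite /c /b mulrCA mulrBr wvn mulr1 -mulrN opprB.
have b0 n : b n != 0 by rewrite mulf_neq0// subr_eq0.
have c0 n : c n != 0 by rewrite -bc conjC_eq0.
have bE n : b n = alpha%:C * (w n - 1) by [].
have cE n : c n = alpha%:C * (v n - 1) by [].
clearbody b c.
have eqS (m n : int) : (m + 1 == n + 1) = (m == n) by exact: (inj_eq (addIr 1)).
(* These two facts are the action of the adjoints of [B] and [Bs] on the basis: [e (n + 1)] goes to
   [e n], respectively to [conj (w n)] times [e n]. *)
have xB n u : form (B u) (e (n + 1)) = form u (e n).
  by apply: total_bounded_eq cU te bB _ u => k; rewrite Be !eo eqS.
have xBs n u : form (Bs u) (e (n + 1)) = w n * form u (e n).
  rewrite -[w n]conjCK -hdotZr; apply: total_bounded_eq cU te bBs _ u => k.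
  rewrite Bse hdotZl hdotZr !eo eqS conjCK.
  by have [->//|_] := eqVneq k n; rewrite !mulr0.
pose x n (u : H) := form u.1 (e n); pose y n (u : H) := form u.2 (e n).
pose E1 n : H := (e n, 0); pose E2 n : H := (0, e n).
have xE n u : x n u = hform u (E1 n) by rewrite dsum_dotE /= hdot0r addr0.
have yE n u : y n u = hform u (E2 n) by rewrite dsum_dotE /= hdot0r add0r.
have xT n u : x (n + 1) (T u) = w n * x n u + b n * y n u.
  by rewrite /x /y /= hdotDl hdotZl hdotBl !xBs xB bE; ring.
have yT n u : y (n + 1) (T u) = y n u by rewrite /y /= add0r xB.
have TE1 n : T (E1 n) = w n *: E1 (n + 1).
  rewrite /T /block_op /= Bse [Bs 0]linear0 [B 0]linear0 subrr scaler0 !addr0.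
  by congr pair; rewrite /= scaler0.
have TE2 n : T (E2 n) = b n *: E1 (n + 1) + E2 (n + 1).
  rewrite /T /block_op /= Bse Be [Bs 0]linear0 !add0r.
  congr pair; rewrite /= ?scaler0 ?addr0 ?add0r//.
  by rewrite -[X in _ - X]scale1r -scalerBl scalerA bE.
have TD u u' : T (u + u') = T u + T u'.
  rewrite /T /block_op; apply: injective_projections; rewrite /= !(linearD B) ?(linearD Bs) ?add0r//.
  by rewrite opprD (addrACA (Bs u.2)) scalerDr [LHS]addrACA.
have [P [PM PL PT PS]] := reducing_projection cH TD redM.
have P0 : P 0 = 0.
  by have := PL 1 0 0; rewrite !scale1r addr0 => /eqP; rewrite -subr_eq0 opprD addrA subrr sub0r oppr_eq0 => /eqP.
have PZ k u : P (k *: u) = k *: P u by rewrite -[k *: u]addr0 PL P0 addr0.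
(* Entries of the block P_mn, with [n] the source index and [m] the target index. *)
pose p11 m n := x m (P (E1 n)); pose p21 m n := y m (P (E1 n)).
pose p12 m n := x m (P (E2 n)); pose p22 m n := y m (P (E2 n)).
have s11 m n : p11 m n = Num.conj (p11 n m) by rewrite /p11 !xE PS hdotC.
have s12 m n : p12 m n = Num.conj (p21 n m) by rewrite /p12 /p21 xE yE PS hdotC.
have s22 m n : p22 m n = Num.conj (p22 n m) by rewrite /p22 !yE PS hdotC.
have s21 m n : p21 m n = Num.conj (p12 n m) by rewrite s12 conjCK.
have xL n k u u' : x n (k *: u + u') = k * x n u + x n u' by rewrite /x /= hdotDl hdotZl.
have yL n k u u' : y n (k *: u + u') = k * y n u + y n u' by rewrite /y /= hdotDl hdotZl.
have xZ n k u : x n (k *: u) = k * x n u by rewrite /x /= hdotZl.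
have yZ n k u : y n (k *: u) = k * y n u by rewrite /y /= hdotZl.
(* [q1] to [q4] are the entries of P_(m+1,n+1) T_n = T_m P_mn, read off from [P T = T P]. *)
have q1 m n : w n * p11 (m + 1) (n + 1) = w m * p11 m n + b m * p21 m n.
  by rewrite /p11 -xZ -PZ -TE1 PT xT.
have q2 m n : w n * p21 (m + 1) (n + 1) = p21 m n.
  by rewrite /p21 -yZ -PZ -TE1 PT yT.
have q3 m n : b n * p11 (m + 1) (n + 1) + p12 (m + 1) (n + 1) = w m * p12 m n + b m * p22 m n.
  by rewrite /p11 /p12 -xL -PL -TE2 PT xT.
have q4 m n : b n * p21 (m + 1) (n + 1) + p22 (m + 1) (n + 1) = p22 m n.
  by rewrite /p21 /p22 -yL -PL -TE2 PT yT.
(* Conjugating the relations for [(n, m)] and using self-adjointness of [P] gives the companion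
   relations with T_m^* and T_n^*. *)
have r1 m n : v m * p11 (m + 1) (n + 1) = v n * p11 m n + c n * p12 m n.
  by have /(congr1 Num.conj) := q1 n m; rewrite rmorphD !rmorphM /= bc -!s11 -s12.
have r2 m n : v m * p12 (m + 1) (n + 1) = p12 m n.
  by have /(congr1 Num.conj) := q2 n m; rewrite !rmorphM /= -!s12.
have r3 m n : c m * p11 (m + 1) (n + 1) + p21 (m + 1) (n + 1) = v n * p21 m n + c n * p22 m n.
  by have /(congr1 Num.conj) := q3 n m; rewrite !rmorphD !rmorphM /= !bc -!s11 -!s21 -s22.
have r4 m n : c m * p12 (m + 1) (n + 1) + p22 (m + 1) (n + 1) = p22 m n.
  by have /(congr1 Num.conj) := q4 n m; rewrite rmorphD !rmorphM /= bc -!s12 -!s22.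
have rel m n := intertwining_entries (wvn n) (wvn m) (wc n) (wc m)
  (q1 m n) (q2 m n) (q3 m n) (q4 m n) (r1 m n) (r2 m n) (r3 m n) (r4 m n).
have off0 m n : (w n - 1) * (v n - 1) != (w m - 1) * (v m - 1) ->
    [/\ p11 m n = 0, p12 m n = 0, p21 m n = 0 & p22 m n = 0].
  move=> t; have [h1 h2 h3 h4] := rel m n.
  apply: (@intertwining_eq0 _ (b n) (c n) (b m) (c m)) => //.
  apply: contra t => /eqP t; apply/eqP; apply: (mulfI (mulf_neq0 aC0 aC0)).
  by move: t; rewrite !bE !cE !(mulrACA _ _ alpha%:C).
have w0 n : w n != 0.
  by apply/eqP => h; have /eqP := wvn n; rewrite h mul0r eq_sym oner_eq0.
(* If the traces agree at [(m, n)], they differ at [(m - 1, n - 1)]; the zero block there is carried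
   one step forward, since T_(n-1) is invertible. *)
have off m n : m != n -> [/\ p11 m n = 0, p12 m n = 0, p21 m n = 0 & p22 m n = 0].
  move=> mn; have [|/off0[z11 z12 z21 z22]] := wsep m n mn; first exact: off0.
  move: (q1 (m - 1) (n - 1)) (q2 (m - 1) (n - 1)) (q3 (m - 1) (n - 1)) (q4 (m - 1) (n - 1)).
  rewrite !subrK z11 z12 z21 z22 !mulr0 !addr0.
  move=> /eqP; rewrite mulf_eq0 (negbTE (w0 _)) => /eqP->.
  move=> /eqP; rewrite mulf_eq0 (negbTE (w0 _)) => /eqP->.
  by rewrite !mulr0 !add0r => -> ->.
pose k := p11 1 1.
pose scal n := [/\ p11 n n = k, p12 n n = 0, p21 n n = 0 & p22 n n = k].
have scal1 : scal 1.
  have [h1 h2 _ _] := rel 0 0; have [_ g _ _] := rel 1 1.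
  move: (q2 0 0) (q4 0 0) (r1 0 0) (r2 0 0); rewrite !add0r => e2 e4 f1 f2.
  have cb : c 0 != b 1.
    by rewrite cE bE; apply: contra w01 => /eqP /(mulfI aC0) /addIr h; apply/eqP.
  have [z12 z21 z] := commuting_scalar (wvn 0) (wc 0) (b0 0) (c0 0) (c0 1) cb
    e2 e4 f1 f2 h1 h2 g.
  by split => //; rewrite -z.
(* The weights are nonzero, so a scalar block propagates along the diagonal in both directions. *)
have scalS n : scal n <-> scal (n + 1).
  split=> [[z11 z12 z21 z22]|[z11 z12 z21 z22]].
    move: (q1 n n) (q2 n n) (r2 n n) (q4 n n); rewrite z11 z12 z21 z22 mulr0 addr0.
    move=> /(mulfI (w0 n)) h11.
    move=> /eqP; rewrite mulf_eq0 (negbTE (w0 _)) => /eqP h21.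
    move=> /eqP; rewrite mulf_eq0 conjC_eq0 (negbTE (w0 _)) => /eqP h12.
    by rewrite h21 mulr0 add0r.
  have h21 := q2 n n; have h12 := r2 n n; have h22 := q4 n n; have h11 := q1 n n.
  rewrite z21 mulr0 in h21; rewrite z12 mulr0 in h12.
  rewrite z21 mulr0 add0r z22 in h22.
  rewrite z11 -h21 mulr0 addr0 in h11.
  by split => //; apply/esym/(mulfI (w0 n)).
have scalN (n : nat) : scal n%:Z /\ scal (- n%:Z).
  have s0 : scal 0 := (scalS 0).2 scal1.
  elim: n => [|n [IH1 IH2]]; first by rewrite oppr0.
  rewrite -addn1 PoszD; split; first exact: (scalS n%:Z).1 IH1.
  by apply: (scalS _).2; rewrite opprD subrK.
have scalA n : scal n.
  case: n => n; first by have [] := scalN n.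
  by rewrite NegzE; have [] := scalN n.+1.
have PE1 n : P (E1 n) = k *: E1 n.
  have [z11 _ z21 _] := scalA n.
  apply/subr0_eq/tH => -[[] m]; rewrite hdotBl hdotZl.
    rewrite -![hform _ _]xE /x /= eo.
    have [<-|nm] := eqVneq n m; first by rewrite -/(x n _) -/(p11 n n) z11 mulr1 subrr.
    rewrite eq_sym in nm; have [h _ _ _] := off m n nm.
    by rewrite -/(x m _) -/(p11 m n) h mulr0 subrr.
  rewrite -![hform _ _]yE /y /= hdot0l mulr0 subr0 -/(y m _) -/(p21 m n).
  have [<-//|nm] := eqVneq n m; rewrite eq_sym in nm.
  by have [_ _ h _] := off m n nm.
have PE2 n : P (E2 n) = k *: E2 n.
  have [_ z12 _ z22] := scalA n.
  apply/subr0_eq/tH => -[[] m]; rewrite hdotBl hdotZl.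
    rewrite -![hform _ _]xE /x /= hdot0l mulr0 subr0 -/(x m _) -/(p12 m n).
    have [<-//|nm] := eqVneq n m; rewrite eq_sym in nm.
    by have [_ h _ _] := off m n nm.
  rewrite -![hform _ _]yE /y /= eo.
  have [<-|nm] := eqVneq n m; first by rewrite -/(y n _) -/(p22 n n) z22 mulr1 subrr.
  rewrite eq_sym in nm; have [_ _ _ h] := off m n nm.
  by rewrite -/(y m _) -/(p22 m n) h mulr0 subrr.
have PF i : P (dsum_family i) = k *: dsum_family i.
  by case: i => -[] n; [exact: PE1|exact: PE2].
have [cM _ _] := redM.
(* [P] acts as [k] on the total family: for [k = 0] the family is orthogonal to [M], and otherwise
   every member is the projection of its multiple by [k^-1] and lies in [M]. *)
have [k0|k0] := eqVneq k 0.
  left; apply/seteqP; split => u /=; last by move=> ->; have [] := cM.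
  move=> Mu; apply: tH => i; have [_ O] := PM (dsum_family i).
  by rewrite PF k0 scale0r subr0 in O; exact: ortho_complC O Mu.
right; apply: (total_closed_subspace cH tH cM) => i.
have [MP _] := PM (k^-1 *: dsum_family i).
by rewrite PZ PF scalerA mulVf// scale1r in MP.
Qed.

End block_shift.

(** * The weights of B(s) for imaginary s *)

Section weights.
Context {R : realType} (lambda : R) (s : R[i]).
Context (s_neq0 : s != 0) (s_imaginary : complex.Re s = 0).
Let a (n : int) : R := n%:~R + (1 + lambda) / 2.
Local Notation w := (shift_weight lambda s).

Let wE n : w n = ((a n)%:C + s) / ((a n)%:C - s).
Proof. by rewrite /shift_weight /a !rmorphD /= rmorph_int. Qed.

Let conj_s : Num.conj s = - s.
Proof. by move: s_imaginary; case: s => x y /= ->; apply/eqP; rewrite eq_complex /= oppr0 !eqxx. Qed.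

Let aDs_neq0 (x : R) : x%:C + s != 0.
Proof.
apply: contra s_neq0 => /eqP h; have := congr1 (@complex.Im R) h; move: s_imaginary.
by case: (s) => p q /= ->; rewrite add0r => ->.
Qed.

Let aBs_neq0 (x : R) : x%:C - s != 0.
Proof.
have : Num.conj (x%:C + s) != 0 by rewrite conjC_eq0.
rewrite rmorphD /= conj_s; congr (_ + _ != 0).
by apply/eqP; rewrite eq_complex /= oppr0 !eqxx.
Qed.

Lemma conj_shift_weight n : Num.conj (w n) = ((a n)%:C - s) / ((a n)%:C + s).
Proof.
have aC : Num.conj (a n)%:C = (a n)%:C :> R[i] by apply/eqP; rewrite eq_complex /= oppr0 !eqxx.
have e : Num.conj ((a n)%:C + s) = (a n)%:C - s.
  by rewrite rmorphD; congr (_ + _).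
rewrite wE rmorphM fmorphV [X in X / _]e; congr (_ / _).
by rewrite -[LHS]/(Num.conj ((a n)%:C - s)) -e conjCK.
Qed.

Lemma shift_weight_unimodular n : w n * Num.conj (w n) = 1.
Proof.
rewrite conj_shift_weight wE; have := aDs_neq0 (a n); have := aBs_neq0 (a n).
by move=> h1 h2; field; rewrite h1 h2.
Qed.

Lemma shift_weight_neq1 n : w n != 1.
Proof.
rewrite wE; apply/eqP => /(congr1 ( *%R^~ ((a n)%:C - s))).
rewrite mul1r mulfVK// => /addrI /eqP; rewrite -addr_eq0 -mulr2n -mulr_natr mulf_eq0 (negbTE s_neq0) /=.
by rewrite pnatr_eq0.
Qed.

(** As [s] is imaginary, this number is |w_n - 1|^2 = 4|s|^2 / (a_n^2 + |s|^2), which depends on [n]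
    only through the square of [a n]. *)
Lemma shift_weight_defect n :
  (w n - 1) * (Num.conj (w n) - 1) = - (4 * s ^+ 2) / ((a n)%:C ^+ 2 - s ^+ 2).
Proof.
rewrite conj_shift_weight wE; have h1 := aDs_neq0 (a n); have h2 := aBs_neq0 (a n).
by field; rewrite h1 h2 subr_sqr mulf_neq0.
Qed.

Lemma shift_weight_defect_inj m n : m != n ->
  (w n - 1) * (Num.conj (w n) - 1) = (w m - 1) * (Num.conj (w m) - 1) ->
  a m = - a n.
Proof.
move=> mn; rewrite !shift_weight_defect => /mulfI h.
have /h /invr_inj /addIr : - (4 * s ^+ 2) != 0 :> R[i].
  by rewrite oppr_eq0 mulf_neq0 ?pnatr_eq0// expf_neq0.
rewrite -!rmorphXn /= => /complexI /eqP; rewrite eqf_sqr => /orP[/eqP|/eqP ->].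
  by move=> /addIr /intr_inj nm; rewrite nm eqxx in mn.
by rewrite opprK.
Qed.

(** Two coincidences would give [a m + a n = 0] and, one index lower, [a m + a n = 2]. *)
Lemma shift_weight_separated m n : m != n ->
  (w n - 1) * (Num.conj (w n) - 1) != (w m - 1) * (Num.conj (w m) - 1) \/
  (w (n - 1) - 1) * (Num.conj (w (n - 1)) - 1) !=
    (w (m - 1) - 1) * (Num.conj (w (m - 1)) - 1).
Proof.
move=> mn; have [e1|] := eqVneq ((w n - 1) * (Num.conj (w n) - 1)) _; last by left.
right; apply/eqP => e2.
have mn1 : m - 1 != n - 1 by rewrite (inj_eq (addIr _)).
have := shift_weight_defect_inj mn1 e2; have := shift_weight_defect_inj mn e1.
by rewrite /a !intrB; lra.
Qed.

(** After cross multiplication the two sides differ by [- 2 s (a m + a n)]. *)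
Lemma conj_shift_weight_neq m n : a m != - a n -> Num.conj (w m) != w n.
Proof.
move=> amn; rewrite conj_shift_weight wE.
have h1 := aDs_neq0 (a m); have h2 := aBs_neq0 (a n).
rewrite eqr_div// -subr_eq0.
have -> : ((a m)%:C - s) * ((a n)%:C - s) - ((a n)%:C + s) * ((a m)%:C + s) =
   - (2 * s * (a m + a n)%:C).
  have -> : (a m + a n)%:C = (a m)%:C + (a n)%:C by exact: rmorphD.
  by move: ((a m)%:C) ((a n)%:C) => x y; ring.
rewrite oppr_eq0 !mulf_neq0 ?pnatr_eq0//.
by rewrite eq_complex /= eqxx andbT addr_eq0.
Qed.

End weights.

Theorem theorem4p3 (R : realType) (lambda alpha : R) (s : R[i])
    (B Bs : {linear L2T R -> L2T R})
    (lambda_bounds : -1 < lambda <= 1)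
    (s_neq0 : s != 0) (s_imaginary : complex.Re s = 0)
    (alpha_gt0 : 0 < alpha)
    (B_bounded : bounded_op (@dotL2T R) B)
    (B_shift : forall n : int, B (zpow R n) = zpow R (n + 1))
    (Bs_bounded : bounded_op (@dotL2T R) Bs)
    (Bs_shift : forall n : int,
      Bs (zpow R n) = shift_weight lambda s n *: zpow R (n + 1)) :
  irreducible (dsum_dot (@dotL2T R) (@dotL2T R))
    (block_op Bs (fun u => alpha%:C *: (Bs u - B u)) (fun=> 0) B).
Proof.
have wv := shift_weight_unimodular lambda s_neq0 s_imaginary.
apply: (@block_shift_irreducible R (L2T R) (@dotL2T R) (zpow R) alpha (shift_weight lambda s) B Bs) => //.
- exact: L2T_complete.
- exact: zpow_total.
- exact: zpow_orthonormal.
- by rewrite gt_eqF.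
- exact: shift_weight_neq1.
- exact: shift_weight_separated.
(* Here [a 0 + a 1 = 2 + lambda], which is positive by the lower bound on [lambda]. *)
- apply: conj_shift_weight_neq => //.
  by apply/eqP; move: lambda_bounds => /andP[? ?]; lra.
Qed.
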